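(* Assume $\kappa>1$. Let $c_2,c_3,c_\lambda>0$ be constants. There exist constants $c_0,c_1,C>0$ (depending only on $c_2,c_3,c_\lambda$) such that the following holds. Suppose $p\ge\frac{c_0\kappa^4\log n}{n}$, $L\le c_2n^{c_3}$, and $\lambda=c_\lambda\frac{1}{\log\kappa}\sqrt{\frac{np\log n}{L}}$. Then with probability at least $1-O(n^{-5})$: (1) the regularized MLE $\theta$ satisfies $\frac{\|e^{\theta}-e^{\theta^*-\bar\theta^*\mathbf 1}\|_\infty}{\|e^{\theta^*-\bar\theta^*\mathbf 1}\|_\infty}\le C\kappa^2\sqrt{\frac{\log n}{npL}}$, where $\bar\theta^*=\frac1n\mathbf 1^\top\theta^*$ and $e^v$ is the entrywise exponential; (2) if moreover $\frac{n^2pL}{2}\ge c_1\frac{\kappa^4n\log n}{\Delta_K^2}$, then the regularized MLE recovers the top-$K$ set exactly, i.e. the $K$ largest entries of $\theta$ are strictly larger than all other entries and occur exactly at indices $\{1,\dots,K\}$.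
   Context: Bradley–Terry–Luce (BTL) setup. There are $n$ items with unknown preference scores $w_1^*\ge w_2^*\ge\cdots\ge w_n^*>0$, all lying in $[w_{\min},w_{\max}]$ with $w_{\min}>0$; set $\theta_i^*=\log w_i^*$ and $\kappa=w_{\max}/w_{\min}$. A comparison graph $\mathcal G=(\{1,\dots,n\},\mathcal E)$ is drawn from the Erdős–Rényi model $\mathcal G_{n,p}$ (each unordered pair is an edge independently with probability $p$). For each edge $(i,j)\in\mathcal E$ one observes $L$ comparisons $y_{i,j}^{(l)}$, $l=1,\dots,L$, where $y_{i,j}^{(l)}=1$ with probability $y^*_{i,j}:=\frac{w_j^*}{w_i^*+w_j^*}$ and $0$ otherwise, with the convention $y_{j,i}^{(l)}=1-y_{i,j}^{(l)}$; all comparisons are mutually independent and independent of $\mathcal G$. Let $y_{i,j}=\frac1L\sum_{l=1}^L y_{i,j}^{(l)}$. Separation: $\Delta_K=\frac{w_K^*-w_{K+1}^*}{w_{\max}}$. Regularized MLE: with $\mathcal L(\theta;y)=\sum_{(i,j)\in\mathcal E,\,i>j}\{-y_{j,i}(\theta_i-\theta_j)+\log(1+e^{\theta_i-\theta_j})\}$ and $\mathcal L_\lambda(\theta;y)=\mathcal L(\theta;y)+\frac\lambda2\|\theta\|_2^2$, the regularized MLE $\theta$ is the minimizer of $\mathcal L_\lambda(\cdot;y)$ over $\mathbb R^n$. *)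

(* Defs.v *)
(* Stdlib Reals for real analysis (exp, ln, sqrt), with MathComp
   finite types / finfun / bigop used only to index coordinates and to form
   finite sums and products (\big[Rplus/0], \big[Rmult/1]) over the finite
   sample space. Indices are 0-based: item i of the paper is index i-1 here. *)
From Stdlib Require Import Reals ClassicalEpsilon.
From mathcomp Require Import all_boot.
Set Implicit Arguments. Unset Strict Implicit. Unset Printing Implicit Defensive.
Local Open Scope R_scope.

(* Sample space: an outcome is (G, Y) where G (i,j) says whether {i,j} is an
   edge (only coordinates with i < j are meaningful) and Y (i,j,l) is the
   comparison outcome y_{i,j}^{(l)} for i < j (1 with probability
   w_j/(w_i+w_j)).  Comparisons are sampled on all pairs, independently of G;
   only those on edges are used by the estimator (equivalent in law to the
   paper's model).  Meaningless coordinates (i >= j) are forced to false. *)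
Notation outcome n L :=
  ({ffun 'I_n * 'I_n -> bool} * {ffun ('I_n * 'I_n) * 'I_L -> bool})%type.

Definition ystar (w : nat -> R) (a b : nat) : R := w b / (w a + w b).

Definition edge_factor (n : nat) (p : R) (G : {ffun 'I_n * 'I_n -> bool})
  (e : 'I_n * 'I_n) : R :=
  if (e.1 < e.2)%N then (if G e then p else 1 - p)
  else (if G e then 0 else 1).

Definition comp_factor (n L : nat) (w : nat -> R)
  (Y : {ffun ('I_n * 'I_n) * 'I_L -> bool}) (t : ('I_n * 'I_n) * 'I_L) : R :=
  if (t.1.1 < t.1.2)%N then
    (if Y t then ystar w t.1.1 t.1.2 else 1 - ystar w t.1.1 t.1.2)
  else (if Y t then 0 else 1).

Definition weight (n L : nat) (p : R) (w : nat -> R) (om : outcome n L) : R :=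
  (\big[Rmult/1]_(e : 'I_n * 'I_n) edge_factor p om.1 e) *
  (\big[Rmult/1]_(t : ('I_n * 'I_n) * 'I_L) comp_factor w om.2 t).

Definition prob (n L : nat) (p : R) (w : nat -> R) (E : outcome n L -> Prop) : R :=
  \big[Rplus/0]_(om : outcome n L)
     (if excluded_middle_informative (E om) then weight p w om else 0).

Definition ybar (n L : nat) (Y : {ffun ('I_n * 'I_n) * 'I_L -> bool})
  (a b : 'I_n) : R :=
  / INR L * \big[Rplus/0]_(l : 'I_L) (if Y (a, b, l) then 1 else 0).

(* negative log-likelihood: for each edge {a,b} with a < b (paper: i = b > j = a)
   the term -y_{a,b} (theta_b - theta_a) + log(1 + e^{theta_b - theta_a}) *)
Definition loss (n L : nat) (om : outcome n L) (th : 'I_n -> R) : R :=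
  \big[Rplus/0]_(e : 'I_n * 'I_n | (e.1 < e.2)%N && om.1 e)
     (- ybar om.2 e.1 e.2 * (th e.2 - th e.1) + ln (1 + exp (th e.2 - th e.1))).

Definition reg_loss (n L : nat) (lam : R) (om : outcome n L) (th : 'I_n -> R) : R :=
  loss om th + lam / 2 * \big[Rplus/0]_(i : 'I_n) (th i) ^ 2.

Definition is_minimizer (n : nat) (f : ('I_n -> R) -> R) (th : 'I_n -> R) : Prop :=
  forall th' : 'I_n -> R, f th <= f th'.

Definition supnorm (n : nat) (v : 'I_n -> R) : R :=
  \big[Rmax/0]_(i : 'I_n) Rabs (v i).

Definition mean_log (n : nat) (w : nat -> R) : R :=
  / INR n * \big[Rplus/0]_(i : 'I_n) ln (w i).

Arguments mean_log : clear implicits.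
Definition wnorm (n : nat) (w : nat -> R) : 'I_n -> R :=
  fun i => exp (ln (w i) - mean_log n w).
Arguments wnorm : clear implicits.

(* Main.v *)
Require Import Defs.
From HB Require Import structures.
From Stdlib Require Import Reals Lra Psatz ClassicalEpsilon FunctionalExtensionality.
From mathcomp Require Import all_boot.
Set Implicit Arguments. Unset Strict Implicit. Unset Printing Implicit Defensive.
Local Open Scope R_scope.
#[local] Arguments pow : simpl never.

(* Write theta = theta^* + delta, with theta^* centered.  The stationarity
   condition for the regularized loss becomes a nonlinear Laplacian equation
     sum_j a_ij h_ij (delta_i - delta_j) + lambda delta_i = r_i ,
   with h_ij the increments of the logistic function.  Continuing h_ij with slope
   1/(36 kappa) outside [-2, 2] makes the equation globally strongly monotone, so
   it has a solution without any a priori bound; once the solution is shown to be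
   smaller than 1 in sup norm the modification is inactive, and convexity
   identifies theta^* + delta with the regularized MLE.

   The l2 size of delta is controlled by the spectral gap of the random graph,
   which Cheeger's inequality deduces from edge expansion (Chernoff bound and
   union bound over vertex sets).  For the sup norm, delta is compared with the
   solution delta^(m) of the equation in which row m of the graph is replaced by
   its expectation and the observations of m are dropped: delta^(m) is
   independent of row m, so Chernoff bounds conditional on the other rows show
   that delta - delta^(m) is small in l2, while the deterministic row m bounds
   delta^(m)_m by the l2 norm.  Maximizing over m closes the estimate.

   All probabilistic inputs are exponents X_k with E exp X_k <= n^-8; they all
   hold as soon as sum_k exp X_k < 1.  Exact top-K recovery follows from the
   sup norm bound. *)

(** * Finite sums and the Euclidean norm *)

HB.instance Definition _ := Monoid.isComLaw.Build R 0 Rplus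
  (fun x y z => esym (Rplus_assoc x y z)) Rplus_comm Rplus_0_l.
HB.instance Definition _ := Monoid.isComLaw.Build R 1 Rmult
  (fun x y z => esym (Rmult_assoc x y z)) Rmult_comm Rmult_1_l.
HB.instance Definition _ := Monoid.isMulLaw.Build R 0 Rmult Rmult_0_l Rmult_0_r.
HB.instance Definition _ := Monoid.isAddLaw.Build R Rmult Rplus
  Rmult_plus_distr_r Rmult_plus_distr_l.

Local Notation "\sum_ i F" := (\big[Rplus/0]_i F) : R_scope.
Local Notation "\sum_ ( i | P ) F" := (\big[Rplus/0]_(i | P) F) : R_scope.
Local Notation "\sum_ ( i <- r ) F" := (\big[Rplus/0]_(i <- r) F) : R_scope.
Local Notation "\sum_ ( i <- r | P ) F" := (\big[Rplus/0]_(i <- r | P) F) : R_scope.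
Local Notation "\sum_ ( i : t ) F" := (\big[Rplus/0]_(i : t) F) : R_scope.
Local Notation "\sum_ ( i : t | P ) F" := (\big[Rplus/0]_(i : t | P) F) : R_scope.
Local Notation "\sum_ ( i < n ) F" := (\big[Rplus/0]_(i < n) F) : R_scope.
Local Notation "\sum_ ( i 'in' A ) F" := (\big[Rplus/0]_(i in A) F) : R_scope.
Local Notation "\prod_ i F" := (\big[Rmult/1]_i F) : R_scope.
Local Notation "\prod_ ( i : t ) F" := (\big[Rmult/1]_(i : t) F) : R_scope.

Section Sums.
Variables (I : Type) (r : seq I) (P : pred I).
Implicit Types f g : I -> R.

Lemma sumR_le f g : (forall i, P i -> f i <= g i) ->
  \sum_(i <- r | P i) f i <= \sum_(i <- r | P i) g i.
Proof. by move=> h; elim/big_ind2: _ => //; [lra | move=> *; lra]. Qed.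

Lemma sumR_ge0 f : (forall i, P i -> 0 <= f i) -> 0 <= \sum_(i <- r | P i) f i.
Proof. by move=> h; elim/big_ind: _ => //; [lra | move=> *; lra]. Qed.

Lemma sumR_opp f : \sum_(i <- r | P i) (- f i) = - \sum_(i <- r | P i) f i.
Proof. by elim/big_rec2: _ => [|i x y _ ->]; lra. Qed.

Lemma sumR_add f g : \sum_(i <- r | P i) (f i + g i) =
  \sum_(i <- r | P i) f i + \sum_(i <- r | P i) g i.
Proof. exact: big_split. Qed.

Lemma sumR_sub f g : \sum_(i <- r | P i) (f i - g i) =
  \sum_(i <- r | P i) f i - \sum_(i <- r | P i) g i.
Proof. by rewrite sumR_add sumR_opp. Qed.

Lemma sumR_mull c f : \sum_(i <- r | P i) (c * f i) = c * \sum_(i <- r | P i) f i.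
Proof. by rewrite big_distrr. Qed.

Lemma sumR_mulr c f : \sum_(i <- r | P i) (f i * c) = (\sum_(i <- r | P i) f i) * c.
Proof. by rewrite big_distrl. Qed.

Lemma sumR_abs f : Rabs (\sum_(i <- r | P i) f i) <= \sum_(i <- r | P i) Rabs (f i).
Proof.
elim/big_rec2: _ => [|i x y _ h]; first by rewrite Rabs_R0; lra.
by have := Rabs_triang (f i) y; lra.
Qed.

End Sums.

Lemma sumR_const (I : finType) (c : R) : \sum_(i : I) c = INR #|I| * c.
Proof.
rewrite big_const; elim: #|I| => [|k IH]; first by rewrite /=; lra.
by rewrite iterS IH S_INR; lra.
Qed.

Lemma sumR_term (I : finType) (f : I -> R) i :
  (forall j, 0 <= f j) -> f i <= \sum_j f j.
Proof.
move=> h; rewrite (bigD1 i) //=.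
by have := @sumR_ge0 _ (index_enum I) (fun j => j != i) f (fun j _ => h j); lra.
Qed.

(** The minimizer [b / c] gives the bound when [c > 0]; when [c = 0] a nonnegative affine function
    must be constant. *)
Lemma quadratic_discriminant (a b c : R) :
  (forall t, 0 <= a - 2 * t * b + t ^ 2 * c) -> 0 <= c -> b ^ 2 <= a * c.
Proof.
move=> h [c0|c0].
  have := h (b / c).
  have -> : a - 2 * (b / c) * b + (b / c) ^ 2 * c = (a * c - b ^ 2) * / c by field; lra.
  move=> k; have := Rmult_le_pos _ _ k (Rlt_le _ _ c0).
  by rewrite Rmult_assoc Rinv_l; lra.
case: (Req_dec b 0) => [->|b0]; first by nra.
(* At this [t] the affine function equals -1. *)
have := h ((a + 1) / (2 * b)); rewrite -c0.
have -> : a - 2 * ((a + 1) / (2 * b)) * b + ((a + 1) / (2 * b)) ^ 2 * 0 = -1 by field.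
lra.
Qed.

Lemma sum_cauchy_schwarz (I : finType) (a f g : I -> R) : (forall i, 0 <= a i) ->
  (\sum_i a i * (f i * g i)) ^ 2 <= (\sum_i a i * f i ^ 2) * (\sum_i a i * g i ^ 2).
Proof.
move=> a0; have sq0 h : 0 <= \sum_i a i * h i ^ 2.
  by apply: sumR_ge0 => i _; apply: Rmult_le_pos => //; apply: pow2_ge_0.
apply: quadratic_discriminant => [t|//].
have -> : \sum_i a i * f i ^ 2 - 2 * t * (\sum_i a i * (f i * g i)) +
    t ^ 2 * (\sum_i a i * g i ^ 2) = \sum_i a i * (f i - t * g i) ^ 2.
  rewrite -!sumR_mull -sumR_sub -sumR_add; apply: eq_bigr => i _ /=; ring.
exact: sq0.
Qed.

Definition l2norm (n : nat) (x : 'I_n -> R) : R := sqrt (\sum_i x i ^ 2).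

Section L2norm.
Variable n : nat.
Implicit Types x y : 'I_n -> R.

Lemma sum_sq_ge0 x : 0 <= \sum_i x i ^ 2.
Proof. by apply: sumR_ge0 => *; apply: pow2_ge_0. Qed.

Lemma l2norm_ge0 x : 0 <= l2norm x.
Proof. exact: sqrt_pos. Qed.

Lemma l2norm_sq x : l2norm x ^ 2 = \sum_i x i ^ 2.
Proof. by rewrite /l2norm pow2_sqrt //; apply: sum_sq_ge0. Qed.

Lemma abs_le_l2norm x i : Rabs (x i) <= l2norm x.
Proof.
have h : x i ^ 2 <= l2norm x ^ 2.
  by rewrite l2norm_sq; apply: (sumR_term (f := fun i => x i ^ 2)) => j; apply: pow2_ge_0.
have := l2norm_ge0 x; split_Rabs; nra.
Qed.

Lemma dot_le_l2norm x y : Rabs (\sum_i x i * y i) <= l2norm x * l2norm y.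
Proof.
have := sum_cauchy_schwarz x y (fun _ => Rle_0_1).
under eq_bigr do rewrite Rmult_1_l; under [X in _ <= X * _]eq_bigr do rewrite Rmult_1_l.
under [X in _ <= _ * X]eq_bigr do rewrite Rmult_1_l; rewrite -!l2norm_sq => h.
have hx := l2norm_ge0 x; have hy := l2norm_ge0 y.
have := Rmult_le_pos _ _ hx hy; split_Rabs; nra.
Qed.

Lemma l2norm_triangle x y : l2norm (fun i => x i + y i) <= l2norm x + l2norm y.
Proof.
have hx := l2norm_ge0 x; have hy := l2norm_ge0 y.
have h := l2norm_ge0 (fun i => x i + y i).
apply: Rsqr_incr_0_var; last lra.
rewrite /Rsqr.
have -> : l2norm (fun i => x i + y i) * l2norm (fun i => x i + y i) =
   l2norm x ^ 2 + 2 * (\sum_i x i * y i) + l2norm y ^ 2.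
  have -> : forall z : R, z * z = z ^ 2 by move=> z; ring.
  rewrite !l2norm_sq -sumR_mull -!big_split; apply: eq_bigr => i _ /=; ring.
by have := dot_le_l2norm x y; split_Rabs; nra.
Qed.

Lemma l2norm_le_bound x b : 0 <= b -> (forall i, Rabs (x i) <= b) ->
  l2norm x <= sqrt (INR n) * b.
Proof.
move=> b0 h; rewrite -[X in _ * X](sqrt_pow2 b) // -sqrt_mult; [|exact: pos_INR|nra].
apply: sqrt_le_1_alt; apply: (Rle_trans _ (\sum_(i < n) b ^ 2)).
  by apply: sumR_le => i _; have := h i; split_Rabs; nra.
by rewrite sumR_const card_ord; lra.
Qed.

End L2norm.

Section Antisymmetric.
Variable n : nat.

Lemma sum_swap_half (f : 'I_n -> 'I_n -> R) :
  \sum_i \sum_j f i j = / 2 * \sum_i \sum_j (f i j + f j i).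
Proof.
have -> : \sum_i \sum_j (f i j + f j i) = \sum_i \sum_j f i j + \sum_i \sum_j f j i.
  by rewrite -sumR_add; apply: eq_bigr => i _; rewrite sumR_add.
by rewrite [X in _ + X]exchange_big /=; lra.
Qed.

Lemma sum_antisym0 (f : 'I_n -> 'I_n -> R) :
  (forall i j, f j i = - f i j) -> \sum_i \sum_j f i j = 0.
Proof.
move=> h; rewrite sum_swap_half big1 ?Rmult_0_r // => i _.
by rewrite big1 // => j _; rewrite h; lra.
Qed.

(** Discrete integration by parts: the pairing of a Laplacian with [z] becomes a Dirichlet form. *)
Lemma sum_antisym_mul (f : 'I_n -> 'I_n -> R) (z : 'I_n -> R) :
  (forall i j, f j i = - f i j) ->
  \sum_i z i * (\sum_j f i j) = / 2 * \sum_i \sum_j f i j * (z i - z j).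
Proof.
move=> h; under eq_bigr => i _ do rewrite -sumR_mull.
rewrite sum_swap_half; congr (_ * _).
by apply: eq_bigr => i _; apply: eq_bigr => j _; rewrite (h i j); ring.
Qed.

Lemma sum_ordered_pairs (f : 'I_n -> 'I_n -> R) : (forall i, f i i = 0) ->
  \sum_i \sum_j f i j = \sum_(e : 'I_n * 'I_n | (e.1 < e.2)%N) (f e.1 e.2 + f e.2 e.1).
Proof.
move=> h; rewrite sumR_add.
have -> : \sum_(e : 'I_n * 'I_n | (e.1 < e.2)%N) f e.2 e.1 =
          \sum_(e : 'I_n * 'I_n | (e.2 < e.1)%N) f e.1 e.2.
  have sK : cancel (fun e : 'I_n * 'I_n => (e.2, e.1)) (fun e => (e.2, e.1)) by case.
  by rewrite (reindex_inj (can_inj sK)).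
rewrite pair_big /= (bigID (fun e : 'I_n * 'I_n => (e.1 < e.2)%N)) /=.
congr (_ + _).
rewrite [LHS](bigID (fun e : 'I_n * 'I_n => (e.2 < e.1)%N)) /=.
rewrite [X in _ + X]big1 ?Rplus_0_r; last first.
  move=> [i j] /= /andP[]; rewrite -!leqNgt => h1 h2.
  by have -> : i = j by apply/val_inj/eqP; rewrite eqn_leq h1 h2.
by apply: eq_bigl => -[i j] /=; case: ltngtP.
Qed.

End Antisymmetric.

(** * Edge expansion and the spectral gap *)

Lemma exists_argmin (I : finType) (P : pred I) (f : I -> R) : (exists i, P i) ->
  exists2 i, P i & forall j, P j -> f i <= f j.
Proof.
case=> i0 Pi0.
suff h (s : seq I) : exists2 i, P i & forall j, P j -> j \in i0 :: s -> f i <= f j.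
  have [i Pi hi] := h (enum I); exists i => // j Pj; apply: hi => //.
  by rewrite inE mem_enum orbT.
elim: s => [|k s [i Pi hi]].
  by exists i0 => // j _; rewrite inE => /eqP ->; lra.
case Pk: (P k); last first.
  exists i => // j Pj; rewrite !inE => /or3P[/eqP->|/eqP jk|js].
  - by apply: hi; rewrite ?inE ?eqxx.
  - by rewrite jk Pk in Pj.
  - by apply: hi => //; rewrite inE js orbT.
case: (Rle_dec (f i) (f k)) => ik.
  exists i => // j Pj; rewrite !inE => /or3P[/eqP->|/eqP->//|js].
  - by apply: hi; rewrite ?inE ?eqxx.
  - by apply: hi => //; rewrite inE js orbT.
have {}ik : f k <= f i by lra.
exists k => // j Pj; rewrite !inE => /or3P[/eqP->|/eqP->|js]; last 1 first.
- by apply: Rle_trans ik _; apply: hi => //; rewrite inE js orbT.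
- by apply: Rle_trans ik _; apply: hi; rewrite ?inE ?eqxx.
- exact: Rle_refl.
Qed.

Definition indic (n : nat) (S : {set 'I_n}) (i : 'I_n) : R := if i \in S then 1 else 0.

Definition pos_set (n : nat) (f : 'I_n -> R) : {set 'I_n} :=
  [set i | if Rlt_dec 0 (f i) then true else false].

Lemma in_pos_set n (f : 'I_n -> R) i : reflect (0 < f i) (i \in pos_set f).
Proof. by rewrite inE; case: Rlt_dec => h; constructor. Qed.

(* Layer-cake argument: peel off the lowest level of f, one at a time. *)
Lemma total_variation_ge0 n (b : 'I_n -> 'I_n -> R) :
  (forall S, 0 <= \sum_i \sum_j b i j * Rabs (indic S i - indic S j)) ->
  forall f : 'I_n -> R, 0 <= \sum_i \sum_j b i j * Rabs (f i - f j).
Proof.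
move=> hb f.
have nonneg (k : nat) : forall g : 'I_n -> R, (#|pos_set g| <= k)%N -> (forall i, 0 <= g i) ->
    0 <= \sum_i \sum_j b i j * Rabs (g i - g j).
  elim: k => [|k IH] g gk g0.
    have gz i : g i = 0.
      case: (Rlt_dec 0 (g i)) => [/in_pos_set gi|]; last by have := g0 i; lra.
      have : (0 < #|pos_set g|)%N by apply/card_gt0P; exists i.
      by rewrite lt0n -leqn0 gk.
    rewrite big1; first lra.
    by move=> i _; rewrite big1 // => j _; rewrite !gz Rminus_0_r Rabs_R0 Rmult_0_r.
  case: (set_0Vmem (pos_set g)) => [g1|[i1 hi1]].
    by apply: IH => //; rewrite g1 cards0.
  have [i0 hi0 himin] : exists2 i, i \in pos_set g & forall j, j \in pos_set g -> g i <= g j.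
    by apply: exists_argmin; exists i1.
  have gi0 : 0 < g i0 by apply/in_pos_set.
  pose g' i := g i - g i0 * indic (pos_set g) i.
  have g'0 i : 0 <= g' i.
    rewrite /g' /indic; case: ifP => [/himin|_]; first lra.
    by have := g0 i; lra.
  (* Subtracting the lowest positive level removes [i0] from the support, so the induction runs on
     the size of the support. *)
  have sub : pos_set g' \subset pos_set g :\ i0.
    apply/subsetP => i /in_pos_set g'i; rewrite in_setD1; apply/andP; split.
      by apply/eqP => ii; move: g'i; rewrite ii /g' /indic hi0; lra.
    apply/in_pos_set; move: g'i; rewrite /g' /indic; case: ifP => _; lra.
  have card' : (#|pos_set g'| <= k)%N.
    have := subset_leq_card sub; have := cardsD1 i0 (pos_set g); rewrite hi0 => e.
    by rewrite e ltnS in gk => /leq_trans; apply.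
  (* [g] is at least [g i0] on its support, so the increments of the indicator and of [g'] never
     have opposite signs and their absolute values add. *)
  have eqn i j : b i j * Rabs (g i - g j) =
      g i0 * (b i j * Rabs (indic (pos_set g) i - indic (pos_set g) j)) +
      b i j * Rabs (g' i - g' j).
    suff -> : Rabs (g i - g j) =
       g i0 * Rabs (indic (pos_set g) i - indic (pos_set g) j) + Rabs (g' i - g' j) by ring.
    have := g'0 i; have := g'0 j; rewrite /g' /indic.
    case: (in_pos_set g i) => hi; case: (in_pos_set g j) => hj.
    - by rewrite Rminus_diag Rabs_R0 => _ _; rewrite Rmult_0_r Rplus_0_l; congr Rabs; ring.
    - by have := g0 j => ? ? ?; rewrite !Rabs_right; lra.
    - by have := g0 i => ? ? ?; rewrite !Rabs_left1; lra.
    - by rewrite Rminus_diag Rabs_R0 => _ _; rewrite Rmult_0_r Rplus_0_l; congr Rabs; ring.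
  under eq_bigr => i _ do under eq_bigr => j _ do rewrite eqn.
  under eq_bigr => i _ do rewrite sumR_add sumR_mull.
  rewrite sumR_add sumR_mull.
  have := Rmult_le_pos _ _ (Rlt_le _ _ gi0) (hb (pos_set g)).
  by have := IH g' card' g'0; lra.
case: n b hb f nonneg => [|n] b hb f nonneg; first by rewrite big_ord0; lra.
have [i0 _ himin] : exists2 i, predT i & forall j, predT j -> f i <= f j.
  by apply: exists_argmin; exists ord0.
have := nonneg _ (fun i => f i - f i0) (leqnn _) (fun i => ltac:(have := himin i isT; lra)).
under eq_bigr => i _ do under eq_bigr => j _ do
  (have -> : f i - f i0 - (f j - f i0) = f i - f j by ring).
done.
Qed.

Lemma continuity_sum (I : Type) (r : seq I) (f : I -> R -> R) :
  (forall i, continuity (f i)) -> continuity (fun c => \sum_(i <- r) f i c).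
Proof.
move=> h; elim: r => [|i r IH].
  have -> : (fun c => \sum_(i <- [::]) f i c) = fun _ => 0.
    by apply: functional_extensionality => c; rewrite big_nil.
  exact: continuity_const.
have -> : (fun c => \sum_(i <- i :: r) f i c) = (f i + (fun c => \sum_(i <- r) f i c))%F.
  by apply: functional_extensionality => c; rewrite big_cons.
exact: continuity_plus.
Qed.

(** The sum is continuous in [c] and changes sign between [- b] and [b]. In Cheeger's argument this
    [c] takes the place of a median. *)
Lemma exists_signed_square_center n (x : 'I_n -> R) :
  exists c, \sum_i (x i - c) * Rabs (x i - c) = 0.
Proof.
pose b := \sum_i Rabs (x i).
have xb i : - b <= x i <= b.
  have := sumR_term (f := fun i => Rabs (x i)) i (fun j => Rabs_pos (x j)).
  by rewrite -/b; split_Rabs; lra.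
have b0 : 0 <= b by apply: sumR_ge0 => *; apply: Rabs_pos.
pose F c := - \sum_i (x i - c) * Rabs (x i - c).
have cF : continuity F.
  apply: continuity_opp; apply: (@continuity_sum _ _ (fun i c => (x i - c) * Rabs (x i - c))).
  move=> i.
  have cs : continuity (fun c => x i - c).
    by apply: continuity_minus; [exact: continuity_const|apply: derivable_continuous; exact: derivable_id].
  apply: continuity_mult => //.
  exact: (continuity_comp _ _ cs Rcontinuity_abs).
have [||c [_ hc]] := IVT_cor F (- b) b cF; first lra; last by exists c; rewrite /F in hc; lra.
have h1 : 0 <= - F (- b).
  rewrite /F Ropp_involutive; apply: sumR_ge0 => i _; have := xb i => h.
  by apply: Rmult_le_pos; [lra|apply: Rabs_pos].
have h2 : 0 <= F b.
  rewrite /F -sumR_opp; apply: sumR_ge0 => i _; have := xb i => h.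
  by have := Rabs_pos (x i - b); nra.
nra.
Qed.

(* Cheeger's inequality.  The expansion hypothesis bounds the total variation
   of the signed squares of x - c below, with c chosen so that these sum to 0;
   Cauchy-Schwarz compares that total variation with the Dirichlet form of x. *)
Lemma cheeger_inequality n (a : 'I_n -> 'I_n -> R) (beta d : R) :
  (forall i j, 0 <= a i j) -> (forall i j, a i j = a j i) ->
  0 <= d -> (forall i, \sum_j a i j <= d) -> 0 <= beta ->
  (forall S : {set 'I_n}, beta * \sum_i \sum_j Rabs (indic S i - indic S j) <=
     \sum_i \sum_j a i j * Rabs (indic S i - indic S j)) ->
  forall z : 'I_n -> R, \sum_i z i = 0 ->
  (beta * INR n) ^ 2 * (\sum_i z i ^ 2) <=
  4 * d * \sum_i \sum_j a i j * (z i - z j) ^ 2.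
Proof.
move=> a0 asym d0 deg beta0 expand z z0.
have [c hc] := exists_signed_square_center z.
set E := \sum_i \sum_j a i j * (z i - z j) ^ 2.
pose u i := z i - c; pose f i := u i * Rabs (u i).
pose U := \sum_i u i ^ 2.
have E0 : 0 <= E.
  by apply: sumR_ge0 => i _; apply: sumR_ge0 => j _; apply: Rmult_le_pos => //; apply: pow2_ge_0.
have U0 : 0 <= U by apply: sumR_ge0 => *; apply: pow2_ge_0.
(* Since [z] sums to zero, recentring it at [c] can only increase its norm. *)
have zU : \sum_i z i ^ 2 <= U.
  have -> : U = \sum_i z i ^ 2 + INR n * c ^ 2.
    rewrite /U /u; under eq_bigr => i _ do
      (have -> : (z i - c) ^ 2 = z i ^ 2 + c ^ 2 - 2 * c * z i by ring).
    by rewrite sumR_sub sumR_add sumR_mull z0 sumR_const card_ord /=; ring.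
  by have := Rmult_le_pos _ _ (pos_INR n) (pow2_ge_0 c); lra.
have tv : beta * (INR n * U) <= \sum_i \sum_j a i j * Rabs (f i - f j).
  have tv0 : 0 <= \sum_i \sum_j (a i j - beta) * Rabs (f i - f j).
    apply: total_variation_ge0 => S; move: (expand S).
    rewrite -sumR_mull; under eq_bigr => i _ do rewrite -sumR_mull.
    move=> h; under eq_bigr => i _ do under eq_bigr => j _ do rewrite Rmult_minus_distr_r.
    under eq_bigr => i _ do rewrite sumR_sub.
    by rewrite sumR_sub; lra.
  (* The signed squares sum to zero, so [n * u i ^ 2] is the absolute value of the sum of
     [f i - f j] over [j]. *)
  have low : INR n * U <= \sum_i \sum_j Rabs (f i - f j).
    rewrite /U -sumR_mull; apply: sumR_le => i _.
    have -> : INR n * u i ^ 2 = Rabs (\sum_j (f i - f j)).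
      rewrite sumR_sub sumR_const card_ord hc Rminus_0_r Rabs_mult.
      rewrite /f Rabs_mult Rabs_Rabsolu (Rabs_right (INR n)); last exact/Rle_ge/pos_INR.
      by rewrite -pow2_abs; ring.
    exact: sumR_abs.
  have eqn : \sum_i \sum_j (a i j - beta) * Rabs (f i - f j) =
     \sum_i \sum_j a i j * Rabs (f i - f j) - beta * \sum_i \sum_j Rabs (f i - f j).
    rewrite -sumR_mull -sumR_sub; apply: eq_bigr => i _.
    by rewrite -sumR_mull -sumR_sub; apply: eq_bigr => j _; ring.
  by have := Rmult_le_compat_l _ _ _ beta0 low; lra.
pose v (e : 'I_n * 'I_n) := Rabs (u e.1) + Rabs (u e.2).
pose D (e : 'I_n * 'I_n) := Rabs (z e.1 - z e.2).
pose A (e : 'I_n * 'I_n) := a e.1 e.2.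
have up : \sum_i \sum_j a i j * Rabs (f i - f j) <= \sum_e A e * (D e * v e).
  rewrite pair_big; apply: sumR_le => -[i j] _; rewrite /A /D /v /=.
  apply: Rmult_le_compat_l; first exact: a0.
  have -> : z i - z j = u i - u j by rewrite /u; ring.
  (* What remains is [|x|x| - y|y|| <= |x - y| (|x| + |y|)]. *)
  rewrite /f; clear; move: (u i) (u j) => x y.
  by split_Rabs; nra.
have cs := @sum_cauchy_schwarz _ A D v (fun e => a0 e.1 e.2).
have eD : \sum_e A e * D e ^ 2 = E.
  by rewrite /E pair_big; apply: eq_bigr => -[i j] _; rewrite /D pow2_abs.
have ev : \sum_e A e * v e ^ 2 <= 4 * d * U.
  apply: (Rle_trans _ (\sum_i \sum_j a i j * (2 * u i ^ 2 + 2 * u j ^ 2))).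
    rewrite pair_big; apply: sumR_le => -[i j] _; rewrite /A /v /=.
    apply: Rmult_le_compat_l; first exact: a0.
    rewrite -(pow2_abs (u i)) -(pow2_abs (u j)).
    by have := pow2_ge_0 (Rabs (u i) - Rabs (u j)); nra.
  rewrite sum_swap_half.
  have -> : / 2 * \sum_i \sum_j (a i j * (2 * u i ^ 2 + 2 * u j ^ 2) +
       a j i * (2 * u j ^ 2 + 2 * u i ^ 2)) =
     / 2 * \sum_i \sum_j (a i j * (4 * u i ^ 2) + a j i * (4 * u j ^ 2)).
    congr (_ * _); apply: eq_bigr => i _; apply: eq_bigr => j _.
    by rewrite (asym j i); ring.
  rewrite -(sum_swap_half (fun i j => a i j * (4 * u i ^ 2))).
  rewrite /U -sumR_mull; apply: sumR_le => i _; rewrite sumR_mulr.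
  by have := Rmult_le_compat_r _ _ _ (pow2_ge_0 (u i)) (deg i); lra.
rewrite eD in cs.
case: (Rle_lt_dec U 0) => [Uz|Upos].
  have -> : \sum_i z i ^ 2 = 0 by have := sum_sq_ge0 z; lra.
  by rewrite Rmult_0_r; apply: Rmult_le_pos => //; lra.
have h0 : 0 <= beta * INR n by apply: Rmult_le_pos => //; exact: pos_INR.
have sq : (beta * INR n * U) ^ 2 <= E * (4 * d * U).
  apply: Rle_trans (Rmult_le_compat_l _ _ _ E0 ev).
  apply: Rle_trans cs; apply: pow_incr; split; last lra.
  by apply: Rmult_le_pos => //; lra.
have h1 : (beta * INR n) ^ 2 * U <= 4 * d * E.
  by apply: (Rmult_le_reg_r U) => //; lra.
have := Rmult_le_compat_l _ _ _ (pow2_ge_0 (beta * INR n)) zU.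
lra.
Qed.

(** * Monotone Laplacian equations and the logistic function *)

(** Difference quotients rather than derivatives, because the clamped logistic increment has
    kinks. *)
Definition slopes_in (n : nat) (mu nu : R) (h : 'I_n -> 'I_n -> R -> R) : Prop :=
  forall i j x y, y <= x -> mu * (x - y) <= h i j x - h i j y <= nu * (x - y).

(** For logistic increments [h] around the true scores, [score_map] minus [full_rhs] is the gradient
    of the regularized loss at the centered true scores shifted by [x]. *)
Definition score_map (n : nat) (a : 'I_n -> 'I_n -> R) (h : 'I_n -> 'I_n -> R -> R)
    (lam : R) (x : 'I_n -> R) (i : 'I_n) : R :=
  \sum_j a i j * h i j (x i - x j) + lam * x i.

Section Existence.
Variables (n : nat) (a : 'I_n -> 'I_n -> R) (h : 'I_n -> 'I_n -> R -> R) (lam nu : R).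
Hypotheses (a_ge0 : forall i j, 0 <= a i j) (lam_gt0 : 0 < lam) (nu_ge0 : 0 <= nu).
Hypotheses (h_slopes : slopes_in 0 nu h) (h0 : forall i j, h i j 0 = 0).

(** Quasi-monotonicity: raising the other coordinates lowers component [i], while raising coordinate
    [i] costs at most its Lipschitz constant times [e]. Both halves of Perron's argument rest on
    it. *)
Lemma field_upper x y i e : x i <= y i <= x i + e -> (forall j, j != i -> x j <= y j) ->
  score_map a h lam y i <= score_map a h lam x i + (\sum_j a i j * nu + lam) * e.
Proof.
move=> hi hj; have e0 : 0 <= e by lra.
suff : \sum_j a i j * h i j (y i - y j) <=
       \sum_j (a i j * h i j (x i - x j) + a i j * nu * e).
  rewrite sumR_add sumR_mulr /score_map.
  by have := Rmult_le_compat_l _ _ _ (Rlt_le _ _ lam_gt0) (proj2 hi); lra.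
apply: sumR_le => j _.
suff : h i j (y i - y j) <= h i j (x i - x j) + nu * e.
  by move=> /(Rmult_le_compat_l _ _ _ (a_ge0 i j)); lra.
case: (altP (j =P i)) => [->|/hj xy].
  by rewrite !Rminus_diag; have := Rmult_le_pos _ _ nu_ge0 e0; lra.
have h1 := @h_slopes i j (x i - x j + e) (y i - y j) ltac:(lra).
have h2 := @h_slopes i j (x i - x j + e) (x i - x j) ltac:(lra).
have E : nu * e = nu * (x i - x j + e - (x i - x j)) by ring.
by lra.
Qed.

(** Maximum principle: at an index where [x] is largest all increments are nonnegative, which leaves
    [lam * x i <= r i]. *)
Lemma subsolution_le r c x : (forall i, r i <= lam * c) ->
  (forall i, score_map a h lam x i <= r i) -> forall i, x i <= c.
Proof.
move=> rc sub i0.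
have [i _ imax] : exists2 i, predT i & forall j, predT j -> - x i <= - x j.
  by apply: exists_argmin; exists i0.
apply: (Rle_trans _ (x i)); first by have := imax i0 isT; lra.
have : 0 <= \sum_j a i j * h i j (x i - x j).
  apply: sumR_ge0 => j _; apply: Rmult_le_pos => //; have hm := imax j isT.
  by have := @h_slopes i j (x i - x j) 0 ltac:(lra); rewrite h0; lra.
have := sub i; have := rc i; rewrite /score_map => *.
by apply: (Rmult_le_reg_l lam) => //; lra.
Qed.

(* Perron's method: the pointwise supremum of all subsolutions is a solution. *)
Lemma field_surjective r : exists x, forall i, score_map a h lam x i = r i.
Proof.
pose c := (\sum_i Rabs (r i)) / lam.
have lamc : lam * c = \sum_i Rabs (r i) by rewrite /c; field; lra.
have rc i : - (lam * c) <= r i <= lam * c.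
  rewrite lamc.
  have := sumR_term (f := fun i => Rabs (r i)) i (fun j => Rabs_pos (r j)).
  by split_Rabs; lra.
pose sub x := forall i, score_map a h lam x i <= r i.
pose E i t := exists2 x, sub x & x i = t.
have bnd i : bound (E i).
  exists c => t [x xs <-]; apply: (subsolution_le _ xs) => j.
  by have := rc j; lra.
have ne i : exists t, E i t.
  exists (- c), (fun _ => - c) => // j; rewrite /score_map big1.
    by have := rc j; lra.
  by move=> k _; rewrite Rminus_diag h0 Rmult_0_r.
pose X i := proj1_sig (completeness (E i) (bnd i) (ne i)).
have Xub x i : sub x -> x i <= X i.
  by move=> xs; rewrite /X; case: completeness => m [ub _] /=; apply: ub; exists x.
have Xclose i e : 0 < e -> exists2 x, sub x & X i - e < x i.
  move=> e0; rewrite /X; case: completeness => m [_ lub] /=.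
  apply: NNPP => no; have := lub (m - e).
  suff /[swap]/[apply] : is_upper_bound (E i) (m - e) by lra.
  move=> t [x xs <-]; apply: Rnot_lt_le => lt; apply: no; by exists x.
pose K i := \sum_j a i j * nu + lam.
have K0 i : 0 < K i.
  rewrite /K; suff : 0 <= \sum_j a i j * nu by lra.
  by apply: sumR_ge0 => j _; apply: Rmult_le_pos.
(* If the field of [X] exceeded [r i], then by [field_upper] so would that of a subsolution close
   enough to [X] at [i]. *)
have Xsub : sub X.
  move=> i; apply: Rnot_lt_le => lt.
  pose e := (score_map a h lam X i - r i) / K i / 2.
  have Ke : K i * e * 2 = score_map a h lam X i - r i.
    by rewrite /e; field; have := K0 i; lra.
  have e0 : 0 < e by have := K0 i; nra.
  have [x xs xe] := Xclose i e e0.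
  have := @field_upper x X i e ltac:(by have := Xub x i xs; lra) (fun j _ => Xub x j xs).
  by rewrite -/(K i); have := xs i; nra.
exists X => i; apply: Rle_antisym; first exact: Xsub.
apply: Rnot_lt_le => lt.
(* With slack at [i], coordinate [i] can be raised by this amount and the result is still a
   subsolution, against the definition of [X] as a supremum. *)
pose e := (r i - score_map a h lam X i) / K i.
have Ke : K i * e = r i - score_map a h lam X i.
  by rewrite /e; field; have := K0 i; lra.
have e0 : 0 < e by have := K0 i; nra.
pose y j := if j == i then X i + e else X j.
suff /(Xub y i) : sub y by rewrite /y eqxx; lra.
move=> j; case: (altP (j =P i)) => [->|ji].
  have := @field_upper X y i e; rewrite -/(K i) {1 2}/y eqxx => /(_ ltac:(lra)) up.
  by apply: Rle_trans (up _) _; [move=> k ki; rewrite /y (negbTE ki); lra|lra].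
have := @field_upper X y j 0; rewrite Rmult_0_r {1 2}/y (negbTE ji) => /(_ ltac:(lra)) up.
apply: Rle_trans (up _) _; last by have := Xsub j; lra.
by move=> k kj; rewrite /y; case: eqP => [->|_]; lra.
Qed.

End Existence.

Section Stability.
Variables (n : nat) (a : 'I_n -> 'I_n -> R) (h : 'I_n -> 'I_n -> R -> R) (lam mu nu : R).
Hypotheses (a_ge0 : forall i j, 0 <= a i j) (a_sym : forall i j, a i j = a j i).
Hypotheses (lam_gt0 : 0 < lam) (mu_ge0 : 0 <= mu).
Hypotheses (h_slopes : slopes_in mu nu h) (h_opp : forall i j d, h j i (- d) = - h i j d).

Lemma sum_field x : \sum_i score_map a h lam x i = lam * \sum_i x i.
Proof.
rewrite /score_map sumR_add sumR_mull sum_antisym0 ?Rplus_0_l // => i j.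
by rewrite -Ropp_minus_distr h_opp a_sym; ring.
Qed.

Lemma sum_eq0_of_field x : \sum_i score_map a h lam x i = 0 -> \sum_i x i = 0.
Proof. by rewrite sum_field => /Rmult_integral [|//]; lra. Qed.

(** Pair the difference of the fields with [x - y]: the slopes and the gap bound the pairing from
    below, Cauchy-Schwarz from above. The zero-sum hypotheses place [x - y] in the subspace where
    the gap holds. *)
Lemma field_strongly_monotone gap x y :
  (forall z : 'I_n -> R, \sum_i z i = 0 ->
     gap * \sum_i z i ^ 2 <= / 2 * \sum_i \sum_j a i j * (z i - z j) ^ 2) ->
  \sum_i score_map a h lam x i = 0 -> \sum_i score_map a h lam y i = 0 ->
  mu * gap * l2norm (fun i => x i - y i) <=
  l2norm (fun i => score_map a h lam x i - score_map a h lam y i).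
Proof.
move=> hgap /sum_eq0_of_field x0 /sum_eq0_of_field y0.
set z := fun i => x i - y i; set s := fun i => _ - score_map _ _ _ _ _.
have z0 : \sum_i z i = 0 by rewrite sumR_sub x0 y0; lra.
pose k i j := a i j * (h i j (x i - x j) - h i j (y i - y j)).
have kopp i j : k j i = - k i j.
  by rewrite /k -(Ropp_minus_distr (x i)) -(Ropp_minus_distr (y i)) !h_opp a_sym; ring.
have sE i : z i * s i = z i * (\sum_j k i j) + lam * z i ^ 2.
  rewrite /s /score_map /k.
  have -> : \sum_j a i j * (h i j (x i - x j) - h i j (y i - y j)) =
     \sum_j a i j * h i j (x i - x j) - \sum_j a i j * h i j (y i - y j).
    by rewrite -sumR_sub; apply: eq_bigr => j _; ring.
  by rewrite /z; ring.
have dot : \sum_i z i * s i = / 2 * (\sum_i \sum_j k i j * (z i - z j)) + lam * \sum_i z i ^ 2.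
  rewrite -sum_antisym_mul // -sumR_mull -sumR_add; exact: eq_bigr.
have low : mu * \sum_i \sum_j a i j * (z i - z j) ^ 2 <= \sum_i \sum_j k i j * (z i - z j).
  rewrite -sumR_mull; apply: sumR_le => i _; rewrite -sumR_mull; apply: sumR_le => j _.
  rewrite /k; have -> : mu * (a i j * (z i - z j) ^ 2) = a i j * (mu * (z i - z j) ^ 2) by ring.
  rewrite Rmult_assoc; apply: Rmult_le_compat_l; first exact: a_ge0.
  have -> : z i - z j = (x i - x j) - (y i - y j) by rewrite /z; ring.
  move: (x i - x j) (y i - y j) => u v.
  case: (Rle_dec v u) => uv.
    by have := h_slopes i j uv; nra.
  have uv' : u <= v by lra.
  by have := h_slopes i j uv'; nra.
have Z0 := sum_sq_ge0 z.
have h1 : mu * gap * l2norm z ^ 2 <= l2norm z * l2norm s.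
  have := dot_le_l2norm z s; rewrite dot l2norm_sq => hd.
  have := Rmult_le_compat_l _ _ _ mu_ge0 (hgap z z0).
  have := Rmult_le_pos _ _ (Rlt_le _ _ lam_gt0) Z0.
  by move: hd; split_Rabs; lra.
have s0 := l2norm_ge0 s.
case: (Rle_lt_or_eq_dec _ _ (l2norm_ge0 z)) => [zpos|<-]; last by rewrite Rmult_0_r.
by apply: (Rmult_le_reg_l (l2norm z)) => //; lra.
Qed.

End Stability.

(** * The logistic function, its convex primitive and its extension *)

Lemma exp_le x y : x <= y -> exp x <= exp y.
Proof. by case=> [/exp_increasing|->]; lra. Qed.

Definition sigm (x : R) : R := / (1 + exp (- x)).

Lemma sigm_opp x : sigm (- x) = 1 - sigm x.
Proof.
rewrite /sigm Ropp_involutive exp_Ropp.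
by have := exp_pos x => ?; field; split; lra.
Qed.

Lemma derivable_pt_lim_sigm x :
  derivable_pt_lim sigm x (exp (- x) / (1 + exp (- x)) ^ 2).
Proof.
have ex := exp_pos (- x).
have d1 : derivable_pt_lim (fun y => exp (- y)) x (- exp (- x)).
  have -> : - exp (- x) = exp (- x) * (- 1) by ring.
  apply: (derivable_pt_lim_comp Ropp exp); last exact: derivable_pt_lim_exp.
  exact: (derivable_pt_lim_opp id _ _ (derivable_pt_lim_id x)).
have d2 : derivable_pt_lim (fct_cte 1 + (fun y => exp (- y)))%F x (0 + - exp (- x)).
  by apply: derivable_pt_lim_plus => //; exact: derivable_pt_lim_const.
have -> : sigm = (fct_cte 1 / (fct_cte 1 + (fun y => exp (- y))))%F.
  apply: functional_extensionality => y.
  by rewrite /sigm /div_fct /plus_fct /fct_cte; field; have := exp_pos (- y); lra.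
have := derivable_pt_lim_div _ _ _ _ _ (derivable_pt_lim_const 1 x) d2.
rewrite /plus_fct /fct_cte => /(_ ltac:(lra)).
congr (derivable_pt_lim _ _ _); rewrite /Rsqr; field; lra.
Qed.

(** By the mean value theorem it suffices to bound the derivative at [c]: it never exceeds 1/4, and
    it is at least [exp (- b) / 4] when [|c| <= b]. *)
Lemma sigm_slope b x y : y <= x -> Rabs x <= b -> Rabs y <= b ->
  exp (- b) / 4 * (x - y) <= sigm x - sigm y <= / 4 * (x - y).
Proof.
case=> [yx|->] xb yb; last by lra.
have [c [-> [yc cx]]] := MVT_cor2 sigm _ y x yx (fun c _ => derivable_pt_lim_sigm c).
have xy : 0 <= x - y by lra.
have ec := exp_pos (- c); have sq : 0 < (1 + exp (- c)) ^ 2 by nra.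
suff : exp (- b) / 4 <= exp (- c) / (1 + exp (- c)) ^ 2 <= / 4.
  by case=> l u; split; apply: Rmult_le_compat_r.
split; apply: (Rmult_le_reg_r _ _ _ sq); rewrite /Rdiv (Rmult_assoc (exp (- c))) Rinv_l; try lra.
  have h1 : exp (- b) <= exp (- c) by apply: exp_le; move: xb yb; split_Rabs; lra.
  have h2 : exp (- b) * exp (- c) <= 1.
    by rewrite -exp_plus -exp_0; apply: exp_le; move: xb yb; split_Rabs; lra.
  have eb := exp_pos (- b).
  have h3 : exp (- b) <= 1.
    by rewrite -exp_0; apply: exp_le; move: xb yb; split_Rabs; lra.
  by nra.
by have := pow2_ge_0 (1 - exp (- c)); lra.
Qed.

(** The tangent line inequality reduces to [exp (s * u) <= 1 - s + s * exp u], which follows from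
    [1 + y <= exp y] at [(1 - s) * u] and at [- s * u]. *)
Lemma softplus_convex x x0 :
  ln (1 + exp x0) + sigm x0 * (x - x0) <= ln (1 + exp x).
Proof.
have e0 := exp_pos x0; have ex := exp_pos x.
pose s := sigm x0; pose u := x - x0.
have s01 : 0 < s < 1.
  rewrite /s /sigm; have := exp_pos (- x0) => ?; split; first by apply: Rinv_0_lt_compat; lra.
  by rewrite -Rinv_1; apply: Rinv_lt_contravar; lra.
have h1 : 1 + (1 - s) * u <= exp ((1 - s) * u) by apply: exp_ineq1_le.
have h2 : 1 + (- s * u) <= exp (- s * u) by apply: exp_ineq1_le.
have key : exp (s * u) <= (1 - s) + s * exp u.
  have es := exp_pos (s * u).
  have e1 : exp u = exp (s * u) * exp ((1 - s) * u) by rewrite -exp_plus; congr exp; ring.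
  have e2 : 1 = exp (s * u) * exp (- s * u).
    rewrite -exp_plus; have -> : s * u + - s * u = 0 by ring.
    by rewrite exp_0.
  have := Rmult_le_compat_l (s * exp (s * u)) _ _ ltac:(nra) h1.
  have := Rmult_le_compat_l ((1 - s) * exp (s * u)) _ _ ltac:(nra) h2.
  by rewrite e1; nra.
have -> : 1 + exp x = (1 + exp x0) * ((1 - s) + s * exp u).
  have -> : exp x = exp x0 * exp u by rewrite -exp_plus; congr exp; rewrite /u; ring.
  by rewrite /s /sigm exp_Ropp; field; lra.
rewrite ln_mult; [|lra|by have := exp_pos (s * u); lra].
suff : s * u <= ln (1 - s + s * exp u) by rewrite -/s -/u; lra.
rewrite -{1}(ln_exp (s * u)); case: key => [lt|<-]; last exact: Rle_refl.
by apply/Rlt_le/ln_increasing => //; exact: exp_pos.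
Qed.

Definition clamp (d : R) : R :=
  if Rle_dec d (- 2) then - 2 else if Rle_dec 2 d then 2 else d.

Lemma clamp_opp d : clamp (- d) = - clamp d.
Proof. by rewrite /clamp; repeat case: Rle_dec => ? /=; lra. Qed.

Lemma clamp_id d : Rabs d <= 2 -> clamp d = d.
Proof. by rewrite /clamp; repeat case: Rle_dec => ? /=; split_Rabs; lra. Qed.

Lemma clamp_bound d : Rabs (clamp d) <= 2.
Proof. by rewrite /clamp; repeat case: Rle_dec => ? /=; split_Rabs; lra. Qed.

Lemma clamp_slope x y : y <= x -> 0 <= clamp x - clamp y <= x - y.
Proof. by rewrite /clamp; repeat case: Rle_dec => ? /=; lra. Qed.

(* The logistic increment at x0, continued with slope mu outside [-2, 2]. *)
Definition sigm_ext (mu x0 d : R) : R :=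
  sigm (x0 + clamp d) - sigm x0 + mu * (d - clamp d).

Lemma sigm_ext0 mu x0 : sigm_ext mu x0 0 = 0.
Proof.
rewrite /sigm_ext clamp_id; last by rewrite Rabs_R0; lra.
by rewrite Rplus_0_r; ring.
Qed.

Lemma sigm_ext_opp mu x0 d : sigm_ext mu (- x0) (- d) = - sigm_ext mu x0 d.
Proof.
by rewrite /sigm_ext clamp_opp -Ropp_plus_distr !sigm_opp; ring.
Qed.

Lemma sigm_ext_eq mu x0 d : Rabs d <= 2 -> sigm_ext mu x0 d = sigm (x0 + d) - sigm x0.
Proof. by move=> /clamp_id e; rewrite /sigm_ext e; ring. Qed.

Lemma sigm_ext_slope mu b x0 x y : Rabs x0 <= b -> mu <= exp (- (b + 2)) / 4 -> mu <= / 4 ->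
  y <= x -> mu * (x - y) <= sigm_ext mu x0 x - sigm_ext mu x0 y <= / 4 * (x - y).
Proof.
move=> xb mb m4 yx; have [c0 c1] := clamp_slope yx.
have hb z : Rabs (x0 + clamp z) <= b + 2.
  by have := Rabs_triang x0 (clamp z); have := clamp_bound z; lra.
have := @sigm_slope (b + 2) (x0 + clamp x) (x0 + clamp y) ltac:(lra) (hb x) (hb y).
have -> : x0 + clamp x - (x0 + clamp y) = clamp x - clamp y by ring.
rewrite /sigm_ext; nra.
Qed.

(** * Chernoff bounds for products of Bernoulli laws *)

Definition bit (b : bool) : R := if b then 1 else 0.

Definition bern (q : R) (b : bool) : R := if b then q else 1 - q.

Lemma sum_bool (f : bool -> R) : \sum_b f b = f true + f false.
Proof. exact: big_bool. Qed.

Section BernoulliProduct.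
Variables (I : finType) (q : I -> R).
Hypothesis q01 : forall i, 0 <= q i <= 1.
Local Notation outc := {ffun I -> bool}.
Implicit Types (x : outc) (f g : outc -> R).

Definition mass x : R := \prod_i bern (q i) (x i).
Definition expect f : R := \sum_x mass x * f x.

Lemma mass_ge0 x : 0 <= mass x.
Proof.
rewrite /mass; elim/big_ind: _ => [||i _]; [lra|exact: Rmult_le_pos|].
by have := q01 i; rewrite /bern; case: (x i); lra.
Qed.

Lemma sum_mass : \sum_x mass x = 1.
Proof.
rewrite -(bigA_distr_bigA (fun i b => bern (q i) b)) big1 // => i _.
by rewrite sum_bool /bern; lra.
Qed.

Lemma expect_le f g : (forall x, f x <= g x) -> expect f <= expect g.
Proof.
by move=> h; apply: sumR_le => x _; apply: Rmult_le_compat_l; [exact: mass_ge0|].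
Qed.

Lemma expect_const c : expect (fun _ => c) = c.
Proof. by rewrite /expect sumR_mulr sum_mass; lra. Qed.

Lemma expect_scale c f : expect (fun x => c * f x) = c * expect f.
Proof. by rewrite /expect -sumR_mull; apply: eq_bigr => x _; ring. Qed.

Definition upd x (i : I) (b : bool) : outc := [ffun j => if j == i then b else x j].

(** Cross-multiplied because [bern (q i) (x i)] may vanish. *)
Lemma mass_upd x i b : mass (upd x i b) * bern (q i) (x i) = mass x * bern (q i) b.
Proof.
rewrite /mass (bigD1 i) //= [in RHS](bigD1 i) //= ffunE eqxx.
have -> : \big[Rmult/1]_(j | j != i) bern (q j) (upd x i b j) =
          \big[Rmult/1]_(j | j != i) bern (q j) (x j).
  by apply: eq_bigr => j ji; rewrite ffunE (negbTE ji).
by ring.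
Qed.

Lemma expect_average i f :
  expect f = expect (fun x => \sum_b bern (q i) b * f (upd x i b)).
Proof.
(* This involution exchanges coordinate [i] with a fresh bit; by [mass_upd] it preserves the joint
   weight. *)
pose phi (u : outc * bool) := (upd u.1 i u.2, u.1 i).
have phiK : involutive phi.
  move=> [x b]; rewrite /phi /= ffunE eqxx; congr (_, _).
  by apply/ffunP => j; rewrite !ffunE; case: eqP => [->|].
rewrite /expect; under [RHS]eq_bigr => x _ do rewrite -sumR_mull.
rewrite pair_big /= (reindex_inj (can_inj phiK)) /=.
rewrite -(pair_big xpredT xpredT (fun x b => mass (upd x i b) *
   (bern (q i) (x i) * f (upd (upd x i b) i (x i))))) /=.
apply: eq_bigr => x _.
have eqn b : mass (upd x i b) * (bern (q i) (x i) * f (upd (upd x i b) i (x i))) =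
   mass x * bern (q i) b * f x.
  rewrite -mass_upd; have -> : upd (upd x i b) i (x i) = x; last by ring.
  by apply/ffunP => j; rewrite !ffunE; case: eqP => [->|].
under eq_bigr => b _ do rewrite eqn.
by rewrite sum_bool /bern; ring.
Qed.

(* The coefficients s j may depend on the outcome, but only through coordinates
   outside the summed family, so the coordinates phi j can be averaged one by one. *)
Lemma expect_exp_sum_le (J : eqType) (js : seq J) (phi : J -> I) (s : J -> outc -> R)
    (v : J -> R) :
  uniq (map phi js) ->
  (forall j (x y : outc), j \in js -> (forall i, i \notin map phi js -> x i = y i) -> s j x = s j y) ->
  (forall j (x : outc), j \in js ->
     \sum_b bern (q (phi j)) b * exp (s j x * (bit b - q (phi j))) <= exp (v j)) ->
  expect (fun x => exp (\sum_(j <- js) s j x * (bit (x (phi j)) - q (phi j)))) <=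
  exp (\sum_(j <- js) v j).
Proof.
elim: js => [|j js IH] /= => [_ _ _|/andP[jjs ujs] inv mgf].
  rewrite big_nil -[X in _ <= X]expect_const.
  by apply: expect_le => x; rewrite big_nil; lra.
rewrite big_cons exp_plus (expect_average (phi j)).
have upd_out x b k : k \in j :: js -> s k (upd x (phi j) b) = s k x.
  move=> kjs; apply: inv => // i; rewrite inE negb_or => /andP[ij _].
  by rewrite ffunE (negbTE ij).
apply: (Rle_trans _ (expect (fun x => exp (v j) *
   exp (\sum_(k <- js) s k x * (bit (x (phi k)) - q (phi k)))))); last first.
  rewrite expect_scale; apply: Rmult_le_compat_l; first exact/Rlt_le/exp_pos.
  apply: IH => // [k x y kjs hxy|k x kjs]; last by apply: mgf; rewrite inE kjs orbT.
  apply: inv => [|i]; first by rewrite inE kjs orbT.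
  by rewrite inE negb_or => /andP[_]; exact: hxy.
apply: expect_le => x.
have eqn b : bern (q (phi j)) b * exp (\sum_(k <- j :: js)
    s k (upd x (phi j) b) * (bit (upd x (phi j) b (phi k)) - q (phi k))) =
  bern (q (phi j)) b * exp (s j x * (bit b - q (phi j))) *
  exp (\sum_(k <- js) s k x * (bit (x (phi k)) - q (phi k))).
  rewrite big_cons exp_plus upd_out ?mem_head // ffunE eqxx Rmult_assoc.
  congr (_ * (_ * exp _)); rewrite !big_seq; apply: eq_bigr => k kjs.
  rewrite upd_out ?inE ?kjs ?orbT // ffunE ifN //.
  by apply: contraNneq jjs => <-; apply: map_f.
under eq_bigr => b _ do rewrite eqn.
rewrite sumR_mulr; apply: Rmult_le_compat_r; first exact/Rlt_le/exp_pos.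
by apply: mgf; rewrite mem_head.
Qed.

End BernoulliProduct.

(** For [s <= 0] use [exp s <= / (1 - s)]; for [s > 0] use it at [s / 2] and square. *)
Lemma exp_le_quadratic s : Rabs s <= 1 -> exp s <= 1 + s + 2 * s ^ 2.
Proof.
have inv x : 0 < 1 - x -> exp x <= / (1 - x).
  move=> x1; apply: (Rmult_le_reg_r (1 - x)) => //; rewrite Rinv_l; last lra.
  have h := exp_ineq1_le (- x); have e := exp_pos x.
  have := Rmult_le_compat_l _ _ _ (Rlt_le _ _ e) h.
  rewrite -exp_plus; have -> : x + - x = 0 by ring.
  by rewrite exp_0; lra.
move=> s1; case: (Rle_dec s 0) => s0.
  apply: (Rle_trans _ (/ (1 - s))); first by apply: inv; lra.
  apply: (Rmult_le_reg_r (1 - s)); first lra.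
  rewrite Rinv_l; last lra.
  by move: s1; split_Rabs; nra.
have s01 : 0 < s <= 1 by move: s1; split_Rabs; lra.
have h := inv (s / 2) ltac:(lra).
have -> : exp s = exp (s / 2) ^ 2.
  by rewrite /pow Rmult_1_r -exp_plus; congr exp; field.
apply: (Rle_trans _ ((/ (1 - s / 2)) ^ 2)).
  by apply: pow_incr; split => //; apply/Rlt_le/exp_pos.
rewrite pow_inv; apply: (Rmult_le_reg_r ((1 - s / 2) ^ 2)); first by nra.
rewrite Rinv_l; last by nra.
have -> : (1 + s + 2 * s ^ 2) * (1 - s / 2) ^ 2 =
  1 + s ^ 2 * ((1 - s) * (5 / 4 - s / 2)) by field.
suff : 0 <= s ^ 2 * ((1 - s) * (5 / 4 - s / 2)) by lra.
apply: Rmult_le_pos; first exact: pow2_ge_0.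
by apply: Rmult_le_pos; lra.
Qed.

(** The factor [q] in the exponent is the variance gain that makes sums over a sparse graph scale
    with the expected degree. *)
Lemma bern_mgf_small q s : 0 <= q <= 1 -> Rabs s <= 1 ->
  \sum_b bern q b * exp (s * (bit b - q)) <= exp (q * (2 * s ^ 2)).
Proof.
move=> q01 s1; rewrite sum_bool /bern /bit.
have -> : q * exp (s * (1 - q)) + (1 - q) * exp (s * (0 - q)) =
  exp (- s * q) * (1 + q * (exp s - 1)).
  have -> : s * (1 - q) = - s * q + s by ring.
  have -> : s * (0 - q) = - s * q by ring.
  by rewrite exp_plus; ring.
apply: (Rle_trans _ (exp (- s * q) * exp (q * (exp s - 1)))).
  by apply: Rmult_le_compat_l; [exact/Rlt_le/exp_pos|exact: exp_ineq1_le].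
rewrite -exp_plus; apply: exp_le.
by have := Rmult_le_compat_l _ _ _ (proj1 q01) (exp_le_quadratic s1); lra.
Qed.

(** Here [s] is unrestricted: when [|s| > 1] the exponent [s * (bit b - q)] is itself below
    [2 * s ^ 2]. *)
Lemma bern_mgf q s : 0 <= q <= 1 ->
  \sum_b bern q b * exp (s * (bit b - q)) <= exp (2 * s ^ 2).
Proof.
move=> q01; case: (Rle_dec (Rabs s) 1) => s1.
  apply: Rle_trans (bern_mgf_small q01 s1) _; apply: exp_le.
  by have := pow2_ge_0 s; nra.
have big c : - 1 <= c <= 1 -> exp (s * c) <= exp (2 * s ^ 2).
  by move=> c1; apply: exp_le; move: s1; split_Rabs; nra.
rewrite sum_bool /bern /bit.
have h1 := Rmult_le_compat_l _ _ _ (proj1 q01) (big (1 - q) ltac:(lra)).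
have h2 := Rmult_le_compat_l (1 - q) _ _ ltac:(lra) (big (0 - q) ltac:(lra)).
lra.
Qed.

Lemma sum_pow_card n (t : R) : \sum_(S : {set 'I_n}) t ^ #|S| = (1 + t) ^ n.
Proof.
transitivity (\prod_(i : 'I_n) (t + 1)).
  rewrite bigA_distr; apply: eq_bigr => S _ /=.
  have -> : t ^ #|S| = \big[Rmult/1]_(i in S) t.
    by rewrite big_const; elim: #|S| => // k IH; rewrite iterS -IH.
  by rewrite [in RHS](bigID (fun i => i \in S)) /= [X in _ = _ * X]big1 ?Rmult_1_r;
    [apply: eq_big => i //=; move=> -> | move=> i /negbTE ->].
by rewrite big_const card_ord; elim: (n) => // k IH; rewrite iterS IH Rplus_comm.
Qed.

(** Serves the union bound over vertex sets, to which a set [S] contributes at most [t ^ #|S|]. *)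
Lemma sum_pow_card_nonempty n (t : R) : 0 <= t -> INR n * t <= 1 ->
  \sum_(S : {set 'I_n} | S != set0) t ^ #|S| <= 3 * (INR n * t).
Proof.
move=> t0 nt.
have e : 1 + \sum_(S : {set 'I_n} | S != set0) t ^ #|S| = (1 + t) ^ n.
  by rewrite -sum_pow_card [in RHS](bigD1 set0) //= cards0.
have nt0 : 0 <= INR n * t by apply: Rmult_le_pos => //; exact: pos_INR.
suff : (1 + t) ^ n <= 1 + 3 * (INR n * t) by rewrite -e; lra.
apply: (Rle_trans _ (exp (INR n * t))).
  elim: (n) => [|k IH]; first by rewrite Rmult_0_l exp_0 /pow; lra.
  rewrite S_INR Rmult_plus_distr_r exp_plus Rmult_1_l Rmult_comm /=.
  apply: Rmult_le_compat; [lra|apply: pow_le; lra| exact: exp_ineq1_le|exact: IH].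
have := @exp_le_quadratic (INR n * t); rewrite Rabs_right; last lra.
by move=> /(_ nt); nra.
Qed.

(** * The leave-one-out comparison *)

Section Supnorm.
Variables (n : nat) (v : 'I_n -> R).

Lemma supnorm_ge0 : 0 <= supnorm v.
Proof.
rewrite /supnorm; elim/big_rec: _ => [|i x _ h]; first lra.
exact: Rle_trans h (Rmax_r _ _).
Qed.

Lemma le_supnorm i : Rabs (v i) <= supnorm v.
Proof.
rewrite /supnorm; have : i \in index_enum 'I_n by rewrite mem_index_enum.
elim: (index_enum _) => // j s IH; rewrite inE big_cons => /orP[/eqP ->|/IH h].
  exact: Rmax_l.
exact: Rle_trans h (Rmax_r _ _).
Qed.

Lemma supnorm_le c : 0 <= c -> (forall i, Rabs (v i) <= c) -> supnorm v <= c.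
Proof. by move=> c0 h; rewrite /supnorm; elim/big_ind: _ => // x y; exact: Rmax_lub. Qed.

End Supnorm.

Lemma sum_off_diagonal_const n (m : 'I_n) (c : R) :
  \sum_(j | j != m) c = (INR n - 1) * c.
Proof.
have := sumR_const 'I_n c; rewrite card_ord (bigD1 m) //= => e.
by apply: (Rplus_eq_reg_l c); rewrite e; ring.
Qed.

Lemma slopes_abs_le n mu (h : 'I_n -> 'I_n -> R -> R) i j x : 0 <= mu ->
  slopes_in mu (/ 4) h -> h i j 0 = 0 -> Rabs (h i j x) <= / 4 * Rabs x.
Proof.
move=> mu0 hs h0; case: (Rle_dec 0 x) => x0.
  have := hs i j _ _ x0; rewrite h0 !Rminus_0_r => hh.
  by have := Rmult_le_pos _ _ mu0 x0; split_Rabs; lra.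
have x0' : x <= 0 by lra.
have := hs i j _ _ x0'; rewrite h0 !Rminus_0_l => hh.
have : 0 <= mu * - x by apply: Rmult_le_pos; lra.
by split_Rabs; lra.
Qed.

Section LeaveOneOut.
Variables (n : nat) (a zeta : 'I_n -> 'I_n -> R) (b : 'I_n -> R) (p lam mu : R).
Variable h : 'I_n -> 'I_n -> R -> R.

Definition full_rhs i := \sum_j a i j * zeta i j - lam * b i.

(* Row and column m of the graph are replaced by their mean, and the
   observations involving m by their expectation. *)
Definition loo_adj (m i j : 'I_n) : R :=
  if i == j then 0 else if (i == m) || (j == m) then p else a i j.

Definition loo_rhs (m i : 'I_n) : R :=
  \sum_j (if (i == m) || (j == m) then 0 else a i j * zeta i j) - lam * b i.

Hypotheses (a01 : forall i j, a i j = 0 \/ a i j = 1) (a_sym : forall i j, a i j = a j i).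
Hypotheses (a_diag : forall i, a i i = 0) (zeta_opp : forall i j, zeta j i = - zeta i j).
Hypotheses (b_sum : \sum_i b i = 0) (p01 : 0 <= p <= 1) (lam_gt0 : 0 < lam) (mu_ge0 : 0 <= mu).
Hypotheses (h_slopes : slopes_in mu (/ 4) h) (h_opp : forall i j d, h j i (- d) = - h i j d).
Hypothesis h0 : forall i j, h i j 0 = 0.

Variables (d : 'I_n -> R) (m : 'I_n) (dm : 'I_n -> R).
Hypotheses (d_eq : forall i, score_map a h lam d i = full_rhs i)
  (dm_eq : forall i, score_map (loo_adj m) h lam dm i = loo_rhs m i).

(** Deterministic placeholders: later [gap] is [N / 256], [ell] is [ln kap], [rho] is [N * eps],
    [sg] is [N * q], and [z] is the noise scale of one pair. *)
Variables gap ell rho sg z : R.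
Hypotheses (rho_ge0 : 0 <= rho) (sg_ge0 : 0 <= sg).
Hypothesis a_gap : forall x : 'I_n -> R, \sum_i x i = 0 ->
  gap * \sum_i x i ^ 2 <= / 2 * \sum_i \sum_j a i j * (x i - x j) ^ 2.
Hypotheses (deg_le : forall i, \sum_j a i j <= 2 * (INR n * p))
  (b_le : forall i, Rabs (b i) <= ell).
Hypotheses (row_noise : forall i, Rabs (\sum_j a i j * zeta i j) <= 12 * rho)
  (pair_noise : forall i j, i != j -> Rabs (zeta i j) <= 10 * z).
Hypotheses (z_rho : INR n * p * z ^ 2 = rho ^ 2) (n_sg : INR n * p <= 2 * sg ^ 2).
Hypothesis row_adj : Rabs (\sum_(j | j != m) (a m j - p) * h m j (dm m - dm j)) <=
  10 * (sg * supnorm dm).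

Lemma sum_full_rhs : \sum_i full_rhs i = 0.
Proof.
rewrite /full_rhs sumR_sub sumR_mull b_sum sum_antisym0; first ring.
by move=> i j; rewrite zeta_opp a_sym; ring.
Qed.

Lemma sum_loo_rhs : \sum_i loo_rhs m i = 0.
Proof.
rewrite /loo_rhs sumR_sub sumR_mull b_sum sum_antisym0; first ring.
by move=> i j; rewrite orbC; case: ifP => _; [lra|rewrite zeta_opp a_sym; ring].
Qed.

Lemma loo_adj_sym i j : loo_adj m i j = loo_adj m j i.
Proof. by rewrite /loo_adj eq_sym orbC a_sym. Qed.

(** The residual left when the leave-one-out solution is put into the full equation. *)
Let s i := full_rhs i - score_map a h lam dm i.

Lemma loo_residual i : s i =
  \sum_j (a i j * zeta i j - (if (i == m) || (j == m) then 0 else a i j * zeta i j)) -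
  \sum_j (a i j - loo_adj m i j) * h i j (dm i - dm j).
Proof.
have e := dm_eq i; rewrite sumR_sub.
under [X in _ - X]eq_bigr => j _ do rewrite Rmult_minus_distr_r.
by rewrite sumR_sub /s /full_rhs /score_map; move: e; rewrite /loo_rhs /score_map; lra.
Qed.

Lemma loo_residual_row : Rabs (s m) <= 12 * rho + 10 * (sg * supnorm dm).
Proof.
rewrite loo_residual.
under eq_bigr => j _ do rewrite eqxx /= Rminus_0_r.
have -> : \sum_j (a m j - loo_adj m m j) * h m j (dm m - dm j) =
    \sum_(j | j != m) (a m j - p) * h m j (dm m - dm j).
  rewrite (bigD1 m) //= Rminus_diag h0 Rmult_0_r Rplus_0_l.
  by apply: eq_bigr => j jm; rewrite /loo_adj eq_sym (negbTE jm) eqxx.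
have h1 := row_noise m; have h2 := row_adj.
apply: Rle_trans (Rabs_triang _ _) _; rewrite Rabs_Ropp.
exact: Rplus_le_compat.
Qed.

(** Away from row [m] the two equations differ only in column [m]. *)
Lemma loo_residual_other i : i != m ->
  s i = a i m * zeta i m - (a i m - p) * h i m (dm i - dm m).
Proof.
move=> im; rewrite loo_residual (negbTE im).
rewrite (bigD1 m) //= eqxx big1 ?Rplus_0_r; last first.
  by move=> j /negbTE ->; lra.
rewrite (bigD1 m) //= big1 ?Rplus_0_r; last first.
  move=> j /negbTE jm; rewrite /loo_adj (negbTE im) jm /=; case: eqP => [<-|_]; last lra.
  by rewrite a_diag; lra.
by rewrite /loo_adj (negbTE im) eqxx Rminus_0_r.
Qed.

(** Keeping [a i m] as a factor lets the sum over [i] produce the degree of [m] instead of [n]. *)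
Lemma loo_residual_other_sq i : i != m ->
  s i ^ 2 <= a i m * (200 * z ^ 2) + (a i m + p) * (supnorm dm ^ 2 / 2).
Proof.
clear b_le; move=> im; rewrite loo_residual_other //.
have h1 : Rabs (h i m (dm i - dm m)) <= supnorm dm / 2.
  apply: Rle_trans (slopes_abs_le _ mu_ge0 h_slopes (h0 _ _)) _.
  by have := le_supnorm dm i; have := le_supnorm dm m; split_Rabs; lra.
have h2 : zeta i m ^ 2 <= 100 * z ^ 2.
  rewrite -pow2_abs; have -> : 100 * z ^ 2 = (10 * z) ^ 2 by ring.
  by apply: pow_incr; split; [apply: Rabs_pos|apply: pair_noise].
have h3 : h i m (dm i - dm m) ^ 2 <= supnorm dm ^ 2 / 4.
  rewrite -pow2_abs; have -> : supnorm dm ^ 2 / 4 = (supnorm dm / 2) ^ 2 by field.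
  by apply: pow_incr; split; [apply: Rabs_pos|].
move: (h i m _) (zeta i m) h2 h3 => x y h2 h3 {h1}.
have B0 := pow2_ge_0 x; have z0 := pow2_ge_0 y.
case: (a01 i m) => ->.
  have -> : (0 * y - (0 - p) * x) ^ 2 = p ^ 2 * x ^ 2 by ring.
  by nra.
have -> : (1 * y - (1 - p) * x) ^ 2 =
  2 * y ^ 2 + 2 * ((1 - p) ^ 2 * x ^ 2) - (y + (1 - p) * x) ^ 2 by ring.
have := pow2_ge_0 (y + (1 - p) * x); have : (1 - p) ^ 2 <= 1 by nra.
by nra.
Qed.

Lemma loo_residual_norm : l2norm s <= 27 * rho + 15 * (sg * supnorm dm).
Proof.
have B0 := supnorm_ge0 dm; have sB : 0 <= sg * supnorm dm by exact: Rmult_le_pos.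
rewrite -(sqrt_pow2 (27 * rho + 15 * (sg * supnorm dm))); last lra.
apply: sqrt_le_1_alt; rewrite (bigD1 m) //=.
have h1 : s m ^ 2 <= (12 * rho + 10 * (sg * supnorm dm)) ^ 2.
  by rewrite -pow2_abs; apply: pow_incr; split; [apply: Rabs_pos|apply: loo_residual_row].
have h2 : \sum_(i | i != m) s i ^ 2 <=
    \sum_i (a i m * (200 * z ^ 2) + (a i m + p) * (supnorm dm ^ 2 / 2)).
  rewrite [X in _ <= X](bigD1 m) //=.
  have := @sumR_le _ (index_enum 'I_n) (fun i => i != m) _ _ loo_residual_other_sq.
  have : 0 <= a m m * (200 * z ^ 2) + (a m m + p) * (supnorm dm ^ 2 / 2).
    by rewrite a_diag; have := pow2_ge_0 (supnorm dm); nra.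
  by move=> u v; apply: Rle_trans v _; rewrite -[X in X <= _]Rplus_0_l; apply: Rplus_le_compat_r.
have h3 : \sum_i (a i m * (200 * z ^ 2) + (a i m + p) * (supnorm dm ^ 2 / 2)) <=
    400 * rho ^ 2 + 3 / 2 * (INR n * p) * supnorm dm ^ 2.
  rewrite sumR_add !sumR_mulr sumR_add sumR_const card_ord.
  have -> : \sum_i a i m = \sum_j a m j by apply: eq_bigr => j _; rewrite a_sym.
  have := deg_le m; have := pow2_ge_0 z; have := pow2_ge_0 (supnorm dm).
  by rewrite -z_rho; nra.
have h4 : INR n * p * supnorm dm ^ 2 <= 2 * (sg * supnorm dm) ^ 2.
  by have := Rmult_le_compat_r _ _ _ (pow2_ge_0 (supnorm dm)) n_sg; lra.
have h5 : 0 <= rho * (sg * supnorm dm) by exact: Rmult_le_pos.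
have h6 := pow2_ge_0 (sg * supnorm dm); have h7 := pow2_ge_0 rho.
(* As a quadratic form in [rho] and [sg * supnorm dm] the left side has coefficients 544, 240 and
   103, below the 729, 810 and 225 of the squared bound. *)
apply: Rle_trans (Rplus_le_compat _ _ _ _ h1 (Rle_trans _ _ _ h2 h3)) _.
by nra.
Qed.

Let a_ge0 i j : 0 <= a i j.
Proof. by case: (a01 i j) => ->; lra. Qed.

(** Strong monotonicity of the full operator at [d] and [dm], whose fields differ by the residual
    [s]. *)
Lemma loo_distance :
  mu * gap * l2norm (fun i => d i - dm i) <= 27 * rho + 15 * (sg * supnorm dm).
Proof.
have d0 : \sum_i d i = 0.
  apply: (sum_eq0_of_field (a := a) (h := h) a_sym lam_gt0 h_opp).
  by rewrite (eq_bigr _ (fun i _ => d_eq i)) sum_full_rhs.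
have dm0 : \sum_i dm i = 0.
  apply: (sum_eq0_of_field (a := loo_adj m) (h := h) loo_adj_sym lam_gt0 h_opp).
  by rewrite (eq_bigr _ (fun i _ => dm_eq i)) sum_loo_rhs.
have := field_strongly_monotone a_ge0 a_sym lam_gt0 mu_ge0 h_slopes h_opp (x := d) (y := dm) a_gap.
rewrite !sum_field // d0 dm0 Rmult_0_r => /(_ erefl erefl) k.
apply: Rle_trans k _; apply: Rle_trans loo_residual_norm; right.
by congr l2norm; apply: functional_extensionality => i; rewrite d_eq.
Qed.

Lemma l2norm_solution : 0 <= ell ->
  mu * gap * l2norm d <= sqrt (INR n) * (12 * rho + lam * ell).
Proof.
move=> ell0.
have d0 : \sum_i d i = 0.
  apply: (sum_eq0_of_field (a := a) (h := h) a_sym lam_gt0 h_opp).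
  by rewrite (eq_bigr _ (fun i _ => d_eq i)) sum_full_rhs.
have := field_strongly_monotone a_ge0 a_sym lam_gt0 mu_ge0 h_slopes h_opp
  (x := d) (y := fun _ => 0) a_gap.
rewrite !sum_field // d0 big1 // Rmult_0_r => /(_ erefl erefl) k.
have f0 i : score_map a h lam (fun _ => 0) i = 0.
  by rewrite /score_map big1 => [|j _]; rewrite ?Rminus_diag ?h0; ring.
have e : (fun i => d i - 0) = d by apply: functional_extensionality => i; ring.
rewrite e in k; apply: Rle_trans k _; apply: l2norm_le_bound.
  by have := Rmult_le_pos _ _ (Rlt_le _ _ lam_gt0) ell0; lra.
move=> i; rewrite f0 Rminus_0_r d_eq /full_rhs.
apply: Rle_trans (Rabs_triang _ _) _; rewrite Rabs_Ropp Rabs_mult (Rabs_right lam); last lra.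
apply: Rplus_le_compat => //; apply: Rmult_le_compat_l => //; lra.
Qed.

(** Row [m] has weight [p] towards every other vertex. Each increment splits into a part of slope at
    least [mu] in [dm m] and a remainder of at most [|dm j| / 4]; the remainders sum to an l1 norm,
    bounded through the l2 norm. *)
Lemma loo_row_value :
  p * (INR n - 1) * mu * Rabs (dm m) <= lam * ell + p / 4 * (sqrt (INR n) * l2norm dm).
Proof.
clear row_noise pair_noise row_adj.
have e : \sum_(j | j != m) p * h m j (dm m - dm j) + lam * dm m = - (lam * b m).
  have := dm_eq m; rewrite /score_map /loo_rhs (bigD1 m) //= [X in _ = X - _]big1; last first.
    by move=> j _; rewrite eqxx.
  rewrite /loo_adj eqxx Rmult_0_l Rplus_0_l Rminus_0_l => <-; congr (_ + _).
  by apply: eq_bigr => j jm; rewrite eq_sym (negbTE jm).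
have l1 : \sum_(j | j != m) Rabs (dm j) <= sqrt (INR n) * l2norm dm.
  apply: (Rle_trans _ (\sum_j Rabs (dm j))).
    rewrite [X in _ <= X](bigD1 m) //= -[X in X <= _]Rplus_0_l.
    by apply: Rplus_le_compat_r; exact: Rabs_pos.
  have := dot_le_l2norm (fun _ => 1) (fun j => Rabs (dm j)).
  under eq_bigr do rewrite Rmult_1_l.
  have -> : l2norm (fun j => Rabs (dm j)) = l2norm dm.
    by rewrite /l2norm; congr sqrt; apply: eq_bigr => j _; rewrite pow2_abs.
  have -> : l2norm (fun _ : 'I_n => 1) = sqrt (INR n).
    by rewrite /l2norm sumR_const card_ord pow1 Rmult_1_r.
  by split_Rabs; lra.
have lb : lam * Rabs (b m) <= lam * ell by apply: Rmult_le_compat_l; [lra|].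
have p4 : p / 4 * \sum_(j | j != m) Rabs (dm j) <= p / 4 * (sqrt (INR n) * l2norm dm).
  by apply: Rmult_le_compat_l => //; lra.
have lamx := Rmult_le_pos _ _ (Rlt_le _ _ lam_gt0) (Rabs_pos (dm m)).
have yb j : - Rabs (dm j) <= dm j <= Rabs (dm j) by split_Rabs; lra.
have pmul u v : u <= v -> p * u <= p * v by move=> uv; apply: Rmult_le_compat_l; lra.
have bm : - (lam * ell) <= lam * b m <= lam * ell.
  by have := Rmult_le_compat_l lam (b m) ell; have := Rmult_le_compat_l lam (- ell) (b m);
    have := b_le m; split_Rabs; lra.
have eqs c : \sum_(j | j != m) (p * (mu * c) - p / 4 * Rabs (dm j)) =
    p * (INR n - 1) * mu * c - p / 4 * \sum_(j | j != m) Rabs (dm j).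
  by rewrite sumR_sub sum_off_diagonal_const sumR_mull; ring.
case: (Rle_dec 0 (dm m)) => x0.
  rewrite Rabs_right in lamx *; last lra.
  have : \sum_(j | j != m) (p * (mu * dm m) - p / 4 * Rabs (dm j)) <=
         \sum_(j | j != m) p * h m j (dm m - dm j).
    apply: sumR_le => j _.
    have h1 := @h_slopes m j (dm m - dm j) (- dm j) ltac:(lra).
    have h2 := slopes_abs_le (- dm j) mu_ge0 h_slopes (h0 m j); rewrite Rabs_Ropp in h2.
    have h3 : mu * dm m - / 4 * Rabs (dm j) <= h m j (dm m - dm j).
      move: h1 h2; have -> : dm m - dm j - - dm j = dm m by ring.
      by split_Rabs; lra.
    by have := pmul _ _ h3; lra.
  by rewrite eqs; lra.
rewrite Rabs_left in lamx *; last lra.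
have : \sum_(j | j != m) p * h m j (dm m - dm j) <=
       \sum_(j | j != m) - (p * (mu * - dm m) - p / 4 * Rabs (dm j)).
  apply: sumR_le => j _.
  have h1 := @h_slopes m j (- dm j) (dm m - dm j) ltac:(lra).
  have h2 := slopes_abs_le (- dm j) mu_ge0 h_slopes (h0 m j); rewrite Rabs_Ropp in h2.
  have h3 : h m j (dm m - dm j) <= - (mu * - dm m) + / 4 * Rabs (dm j).
    move: h1 h2; have -> : - dm j - (dm m - dm j) = - dm m by ring.
    by split_Rabs; lra.
  by have := pmul _ _ h3; lra.
by rewrite sumR_opp eqs; lra.
Qed.

End LeaveOneOut.

(** * The estimator as a solution of the modified equation *)

(* Twice the constant produced by [bootstrap]: 2562048 = 278 * 9216 and
   165960 = 72 + 18 * 9216, where 9216 = 36 * 256 comes from the slope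
   1 / (36 kappa) and the spectral gap n p / 256. *)
Definition err_const (c : R) : R := 2 * (2562048 + 165960 * c).

(** [eta] is the l2 distance between the full and the leave-one-out solution, [D] and [B] are their
    sup norms, [dl] is the l2 norm of the full one, and [x] is the leave-one-out value at [m]. The
    final coefficient of [D] is below 1, so a maximum over [m] can be absorbed. *)
Lemma bootstrap (kap c eps q N n sn p eta B D dl x : R) :
  1 <= kap -> 0 <= c -> 0 <= eps -> 0 <= q -> 0 < n -> 0 < p <= 1 -> N = n * p -> 2 <= n ->
  0 <= sn -> sn ^ 2 = n -> 0 <= eta -> 0 <= B -> 0 <= dl -> 0 <= x ->
  kap ^ 2 * q * err_const c <= 1 -> err_const c ^ 2 * kap ^ 4 <= 2 * n ->
  / (36 * kap) * (N / 256) * eta <= 27 * (N * eps) + 15 * (N * q * B) ->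
  / (36 * kap) * (N / 256) * dl <= sn * (12 * (N * eps) + c * (N * eps)) ->
  p * (n - 1) * / (36 * kap) * x <= c * (N * eps) + p / 4 * (sn * (dl + eta)) ->
  B <= D + eta ->
  x + eta <= / 2 * err_const c * (kap ^ 2 * eps) + 2 / 7 * D.
Proof.
move=> k1 c0 e0 q0 n0 p01 NE n2 sn0 snE eta0 B0 dl0 x0 kq kn h1 h2 h3 h4.
have N0 : 0 < N by rewrite NE; apply: Rmult_lt_0_compat; lra.
have C0 : 5124096 <= err_const c by rewrite /err_const; nra.
have kk : kap <= kap ^ 2 by nra.
have g1 : eta <= 9216 * kap * (27 * eps + 15 * (q * B)).
  apply: (Rmult_le_reg_l (/ (36 * kap) * (N / 256))).
    by apply: Rmult_lt_0_compat; [apply: Rinv_0_lt_compat; lra|lra].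
  by apply: Rle_trans h1 _; right; field; lra.
have g2 : dl <= 9216 * kap * (sn * ((12 + c) * eps)).
  apply: (Rmult_le_reg_l (/ (36 * kap) * (N / 256))).
    by apply: Rmult_lt_0_compat; [apply: Rinv_0_lt_compat; lra|lra].
  by apply: Rle_trans h2 _; right; field; lra.
have kqs : kap * q * 5124096 <= 1.
  have : kap * q <= kap ^ 2 * q by apply: Rmult_le_compat_r.
  have : 0 <= kap * q by apply: Rmult_le_pos; lra.
  by nra.
(* Smallness of [kap * q] turns the feedback term into [B / 8]; then [B <= D + eta] is solved for
   [eta]. *)
have g3 : eta <= 284380 * (kap * eps) + D / 7.
  have : 9216 * kap * (15 * (q * B)) <= B / 8.
    have : kap * q * 5124096 * B <= 1 * B by apply: Rmult_le_compat_r.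
    have : 0 <= kap * q * B by apply: Rmult_le_pos => //; apply: Rmult_le_pos; lra.
    by lra.
  have : 0 <= kap * eps by apply: Rmult_le_pos; lra.
  by lra.
have snpos : 0 < sn by case: sn0 => // e; rewrite -e in snE; lra.
(* This makes [eta] re-enter the row estimate with coefficient at most 1, so [x + eta] contains
   [eta] twice, whence [2 / 7 * D]. *)
have snk : 18 * kap <= sn.
  apply: Rsqr_incr_0_var => //; rewrite !Rsqr_pow2 snE.
  have : 5124096 ^ 2 <= err_const c ^ 2 by apply: pow_incr; lra.
  have -> : (18 * kap) ^ 2 = 324 * kap ^ 2 by ring.
  have k2 : 1 <= kap ^ 2 by nra.
  have k4 : kap ^ 2 <= kap ^ 4.
    have -> : kap ^ 4 = kap ^ 2 * kap ^ 2 by ring.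
    by nra.
  move=> hc; have : 5124096 ^ 2 * kap ^ 2 <= err_const c ^ 2 * kap ^ 4.
    by apply: Rmult_le_compat => //; nra.
  by nra.
have g4 : x <= 72 * kap * (c * eps) + 18 * kap * ((dl + eta) / sn).
  have h3' : n / 2 * / (36 * kap) * x <= c * (n * eps) + / 4 * (sn * (dl + eta)).
    apply: (Rmult_le_reg_l p); first lra.
    apply: (Rle_trans _ (p * (n - 1) * / (36 * kap) * x)); last first.
      by apply: Rle_trans h3 _; right; rewrite NE; field.
    have : 0 <= / (36 * kap) * x.
      by apply: Rmult_le_pos => //; apply/Rlt_le/Rinv_0_lt_compat; lra.
    move=> h; have ph : 0 <= p * (/ (36 * kap) * x) by apply: Rmult_le_pos; lra.
    by have := Rmult_le_compat_r _ (n / 2) (n - 1) ph ltac:(lra); lra.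
  apply: (Rmult_le_reg_l (n / 2 * / (36 * kap))).
    by apply: Rmult_lt_0_compat; [lra|apply: Rinv_0_lt_compat; lra].
  apply: Rle_trans h3' _; right; rewrite -snE; field; lra.
have g5 : 18 * kap * ((dl + eta) / sn) <= 165888 * (kap ^ 2 * ((12 + c) * eps)) + eta.
  have -> : 18 * kap * ((dl + eta) / sn) = 18 * kap * (dl / sn) + 18 * kap / sn * eta by field; lra.
  apply: Rplus_le_compat.
    have : dl / sn <= 9216 * kap * ((12 + c) * eps).
      apply: (Rmult_le_reg_l sn) => //; apply: (Rle_trans _ dl); first by right; field; lra.
      by apply: Rle_trans g2 _; right; ring.
    by move=> h; have := Rmult_le_compat_l (18 * kap) _ _ ltac:(lra) h; lra.
  rewrite -[X in _ <= X]Rmult_1_l; apply: Rmult_le_compat_r => //.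
  by apply: (Rmult_le_reg_r sn) => //; rewrite /Rdiv Rmult_assoc Rinv_l; lra.
have ke : kap * eps <= kap ^ 2 * eps by apply: Rmult_le_compat_r.
have kce : kap * (c * eps) <= kap ^ 2 * (c * eps).
  by apply: Rmult_le_compat_r => //; apply: Rmult_le_pos.
have K0 : 0 <= kap ^ 2 * eps by nra.
rewrite /err_const; lra.
Qed.

Lemma exp_minus_one_le x : Rabs x <= 1 -> Rabs (exp x - 1) <= 3 * Rabs x.
Proof.
move=> x1; have := exp_le_quadratic x1; have := exp_ineq1_le x.
by move: x1; split_Rabs; nra.
Qed.

Section Estimator.
Variables (n L : nat).

(** An unordered pair is read at its increasing ordering, the only kind of coordinate that carries
    information in the sample space. *)
Definition edge (i j : 'I_n) : 'I_n * 'I_n := if (i < j)%N then (i, j) else (j, i).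

Lemma edge_sym i j : edge i j = edge j i.
Proof.
by rewrite /edge; case: ltngtP => // e; rewrite (val_inj e).
Qed.

Lemma edge_eq i j k l : edge i j = edge k l -> (i = k /\ j = l) \/ (i = l /\ j = k).
Proof. by rewrite /edge; case: ifP => _; case: ifP => _ [-> ->]; auto. Qed.

Lemma edge_lt i j : i != j -> ((edge i j).1 < (edge i j).2)%N.
Proof. by rewrite /edge -val_eqE neq_ltn; case: ifP. Qed.

Definition adj (G : {ffun 'I_n * 'I_n -> bool}) (i j : 'I_n) : R :=
  if i == j then 0 else bit (G (edge i j)).

Lemma adj01 G i j : adj G i j = 0 \/ adj G i j = 1.
Proof. by rewrite /adj /bit; case: eqP => _; [left|case: (G _); [right|left]]. Qed.

Lemma adj_sym G i j : adj G i j = adj G j i.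
Proof. by rewrite /adj edge_sym eq_sym. Qed.

Lemma adj_diag G i : adj G i i = 0.
Proof. by rewrite /adj eqxx. Qed.

Variable w : nat -> R.

Definition pair_sign (i j : 'I_n) : R :=
  if (i < j)%N then - 1 else if (j < i)%N then 1 else 0.

Lemma pair_sign_opp i j : pair_sign j i = - pair_sign i j.
Proof. by rewrite /pair_sign; case: ltngtP => _; lra. Qed.

(* The empirical frequency with which i beats j, minus its mean; bits are stored
   at (min, max) and record a win of the larger index. *)
Definition noise (Y : {ffun ('I_n * 'I_n) * 'I_L -> bool}) (i j : 'I_n) : R :=
  / INR L * (pair_sign i j *
    \sum_(l : 'I_L) (bit (Y (edge i j, l)) - ystar w (edge i j).1 (edge i j).2)).

Lemma noise_opp Y i j : noise Y j i = - noise Y i j.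
Proof. by rewrite /noise pair_sign_opp edge_sym; ring. Qed.

Definition center (i : 'I_n) : R := ln (w i) - mean_log n w.

Hypothesis w_gt0 : forall i, (i < n)%N -> 0 < w i.
Hypothesis L_gt0 : (0 < L)%N.

Lemma sum_center : (0 < n)%N -> \sum_i center i = 0.
Proof.
move=> n0; rewrite /center sumR_sub sumR_const card_ord /mean_log.
rewrite -Rmult_assoc Rinv_r ?Rmult_1_l; first exact: Rminus_diag.
by apply/not_0_INR/eqP; rewrite -lt0n.
Qed.

Lemma sigm_center (i j : 'I_n) : sigm (center i - center j) = ystar w j i.
Proof.
have wi := w_gt0 (ltn_ord i); have wj := w_gt0 (ltn_ord j).
have -> : center i - center j = ln (w i) - ln (w j) by rewrite /center; ring.
rewrite /sigm /ystar Ropp_minus_distr /Rminus exp_plus exp_Ropp !exp_ln //.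
by field; lra.
Qed.

Lemma noise_gt Y (i j : 'I_n) : (i < j)%N ->
  noise Y j i = ybar Y i j - sigm (center j - center i).
Proof.
move=> ij; rewrite sigm_center /noise edge_sym /edge ij /pair_sign ltnNge (ltnW ij) /= ij.
rewrite sumR_sub sumR_const card_ord Rmult_1_l Rmult_minus_distr_l -Rmult_assoc Rinv_l.
  by rewrite Rmult_1_l.
by apply/not_0_INR/eqP; rewrite -lt0n.
Qed.

(** Tangent lines of the softplus at the stationary point [t] bound the loss from below,
    stationarity evaluates their linear terms, and the ridge penalty leaves the squared distance to
    [t]. *)
Lemma minimizer_unique (om : outcome n L) (lam : R) (t th : 'I_n -> R) : 0 < lam ->
  (forall i, \sum_j adj om.1 i j * (sigm (t i - t j) - sigm (center i - center j)) + lam * t i =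
     \sum_j adj om.1 i j * noise om.2 i j) ->
  is_minimizer (reg_loss lam om) th -> forall i, th i = t i.
Proof.
move=> lam0 grad /(_ t) min.
pose z i := th i - t i.
pose K i j := adj om.1 i j * (sigm (t i - t j) - sigm (center i - center j) - noise om.2 i j).
have Kopp i j : K j i = - K i j.
  rewrite /K -(Ropp_minus_distr (t i)) -(Ropp_minus_distr (center i)) !sigm_opp noise_opp adj_sym.
  by ring.
have step (e : 'I_n * 'I_n) : (e.1 < e.2)%N && om.1 e ->
    - ybar om.2 e.1 e.2 * (t e.2 - t e.1) + ln (1 + exp (t e.2 - t e.1)) +
    K e.2 e.1 * (z e.2 - z e.1) <=
    - ybar om.2 e.1 e.2 * (th e.2 - th e.1) + ln (1 + exp (th e.2 - th e.1)).
  case: e => i j /= /andP[ij Gij].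
  have -> : K j i = sigm (t j - t i) - ybar om.2 i j.
    rewrite /K noise_gt // /adj edge_sym /edge ij Gij /bit.
    by rewrite -val_eqE /= gtn_eqF // ; ring.
  by have := softplus_convex (th j - th i) (t j - t i); rewrite /z; lra.
have := @sumR_le _ (index_enum _) (fun e : 'I_n * 'I_n => (e.1 < e.2)%N && om.1 e) _ _ step.
rewrite sumR_add -/(loss om t) -/(loss om th).
have -> : \sum_(e : 'I_n * 'I_n | (e.1 < e.2)%N && om.1 e) K e.2 e.1 * (z e.2 - z e.1) =
    \sum_i z i * (\sum_j K i j).
  rewrite sum_antisym_mul // sum_ordered_pairs; last by move=> i; ring.
  rewrite -sumR_mull big_mkcondr; apply: eq_bigr => -[i j] /= ij.
  case: ifP => Gij; rewrite (Kopp j i); first by field.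
  have -> : K j i = 0; last by ring.
  by rewrite /K /adj edge_sym /edge ij Gij /bit; case: eqP => _; ring.
have -> : \sum_i z i * (\sum_j K i j) = - (lam * \sum_i z i * t i).
  rewrite -sumR_mull -sumR_opp; apply: eq_bigr => i _.
  have -> : \sum_j K i j = - (lam * t i); last by ring.
  rewrite /K; under eq_bigr => j _ do rewrite Rmult_minus_distr_l.
  by rewrite sumR_sub; have := grad i; lra.
(* Polarization exhibits the remainder [\sum_i z i ^ 2], which minimality of [th] forces to
   vanish. *)
have -> : \sum_i z i * t i = / 2 * (\sum_i th i ^ 2 - \sum_i t i ^ 2 - \sum_i z i ^ 2).
  by rewrite -!sumR_sub -sumR_mull; apply: eq_bigr => i _; rewrite /z; field.
pose A := \sum_i th i ^ 2; pose B := \sum_i t i ^ 2; pose Z := \sum_i z i ^ 2.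
rewrite -/A -/B -/Z => h2.
have h1 : loss om th + lam / 2 * A <= loss om t + lam / 2 * B by exact: min.
have zs : Z <= 0 by apply: (Rmult_le_reg_l lam) => //; lra.
move=> i; have : z i ^ 2 <= 0.
  by apply: Rle_trans zs; apply: (sumR_term (f := fun i => z i ^ 2)) => j; apply: pow2_ge_0.
by rewrite /z => ?; nra.
Qed.

End Estimator.

(** * Moment generating functions of the model *)

(** Success probability 0 on the meaningless coordinates makes [weight] a product of Bernoulli
    masses. *)
Definition edge_prob (n : nat) (p : R) (e : 'I_n * 'I_n) : R :=
  if (e.1 < e.2)%N then p else 0.

Definition comp_prob (n L : nat) (w : nat -> R) (t : ('I_n * 'I_n) * 'I_L) : R :=
  if (t.1.1 < t.1.2)%N then ystar w t.1.1 t.1.2 else 0.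

Lemma weight_mass n L p w (om : outcome n L) :
  weight p w om = mass (@edge_prob n p) om.1 * mass (@comp_prob n L w) om.2.
Proof.
rewrite /weight /mass /edge_factor /comp_factor /edge_prob /comp_prob /bern.
by congr (_ * _); apply: eq_bigr => i _; case: ifP => _; case: ifP => _; lra.
Qed.

Lemma expect_exchange (I J : finType) (q : I -> R) (r : J -> R)
    (f : {ffun I -> bool} -> {ffun J -> bool} -> R) :
  expect q (fun x => expect r (f x)) = expect r (fun y => expect q (f^~ y)).
Proof.
rewrite /expect; under eq_bigr => x _ do rewrite -sumR_mull.
rewrite exchange_big; apply: eq_bigr => y _ /=; rewrite -sumR_mull.
by apply: eq_bigr => x _; ring.
Qed.

Lemma expect_sum (I K : finType) (q : I -> R) (P : pred K) (f : K -> {ffun I -> bool} -> R) :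
  expect q (fun x => \sum_(k | P k) f k x) = \sum_(k | P k) expect q (f k).
Proof.
rewrite /expect; under eq_bigr => x _ do rewrite -sumR_mull.
by rewrite exchange_big.
Qed.

Lemma expect_add (I : finType) (q : I -> R) (f g : {ffun I -> bool} -> R) :
  expect q (fun x => f x + g x) = expect q f + expect q g.
Proof. by rewrite /expect -sumR_add; apply: eq_bigr => x _; ring. Qed.

Section Mgf.
Variables (n L : nat) (p : R) (w : nat -> R).
Hypotheses (p01 : 0 <= p <= 1) (w_gt0 : forall i, (i < n)%N -> 0 < w i).
Hypothesis L_gt0 : (0 < L)%N.

Lemma edge_prob01 (e : 'I_n * 'I_n) : 0 <= edge_prob p e <= 1.
Proof. by rewrite /edge_prob; case: ifP => _; lra. Qed.

Lemma comp_prob01 (t : ('I_n * 'I_n) * 'I_L) : 0 <= comp_prob w t <= 1.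
Proof.
rewrite /comp_prob /ystar; case: ifP => _; last lra.
have w1 := w_gt0 (ltn_ord t.1.1); have w2 := w_gt0 (ltn_ord t.1.2).
split; first by apply/Rlt_le/Rdiv_lt_0_compat; lra.
by apply: (Rmult_le_reg_r (w t.1.1 + w t.1.2)); rewrite /Rdiv ?Rmult_assoc ?Rinv_l; lra.
Qed.

(** Distinct indices give distinct unordered edges, hence independent bits; the coefficients may
    depend on the rest of the graph. *)
Lemma adj_mgf (J : finType) (P : pred J) (f : J -> 'I_n * 'I_n)
    (s : J -> {ffun 'I_n * 'I_n -> bool} -> R) (t : R) : 0 <= t <= 1 ->
  (forall j, P j -> (f j).1 != (f j).2) ->
  (forall j k, P j -> P k -> edge (f j).1 (f j).2 = edge (f k).1 (f k).2 -> j = k) ->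
  (forall j G, P j -> Rabs (s j G) <= t) ->
  (forall j (G H : {ffun 'I_n * 'I_n -> bool}), P j ->
     (forall e, (forall k, P k -> e <> edge (f k).1 (f k).2) -> G e = H e) -> s j G = s j H) ->
  expect (edge_prob p) (fun G => exp (\sum_(j | P j) s j G * (adj G (f j).1 (f j).2 - p))) <=
  exp (\sum_(j | P j) p * (2 * t ^ 2)).
Proof.
move=> t01 neq inj st inv.
pose phi j := edge (f j).1 (f j).2.
have uphi : uniq (map phi (enum P)).
  rewrite map_inj_in_uniq ?enum_uniq // => j k; rewrite !mem_enum => Pj Pk; exact: inj.
have qphi j : P j -> edge_prob p (phi j) = p.
  by move=> Pj; rewrite /edge_prob edge_lt // neq.
have := @expect_exp_sum_le _ _ edge_prob01 _ (enum P) phi s (fun _ => p * (2 * t ^ 2)) uphi.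
rewrite big_enum; set X := expect _ _; set Y := expect _ _.
have -> : X = Y.
  congr expect; apply: functional_extensionality => G; congr exp.
  rewrite big_enum; apply: eq_bigr => j Pj.
  by rewrite qphi // /adj (negbTE (neq j Pj)).
apply=> [j G H|j G]; rewrite mem_enum => Pj.
  move=> GH; apply: inv => // e he; apply: GH; apply/mapP => -[k].
  by rewrite mem_enum => /he.
rewrite qphi //; apply: Rle_trans (bern_mgf_small p01 _) _; first by have := st j G Pj; lra.
apply: exp_le; apply: Rmult_le_compat_l; first lra.
apply: Rmult_le_compat_l; first lra.
by rewrite -pow2_abs; apply: pow_incr; split; [apply: Rabs_pos|apply: st].
Qed.

(** Coefficients that are functions of the graph away from [m] are allowed, which takes the place of
    conditioning on the other rows. *)
Lemma row_mgf (m : 'I_n) (s : 'I_n -> {ffun 'I_n * 'I_n -> bool} -> R) (t : R) : 0 <= t <= 1 ->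
  (forall j G, j != m -> Rabs (s j G) <= t) ->
  (forall j (G H : {ffun 'I_n * 'I_n -> bool}), j != m ->
     (forall i k, i != k -> i != m -> k != m -> adj G i k = adj H i k) -> s j G = s j H) ->
  expect (edge_prob p) (fun G => exp (\sum_(j | j != m) s j G * (adj G m j - p))) <=
  exp (2 * t ^ 2 * (INR n * p)).
Proof.
move=> t01 st inv.
have := @adj_mgf 'I_n (fun j => j != m) (fun j => (m, j)) s t t01 => /=.
move=> h; apply: Rle_trans (h _ _ st _) _.
- by move=> j; rewrite eq_sym.
- by move=> j k jm km /edge_eq [[_ ->]|[<- ->]].
- move=> j G H jm GH; apply: inv => // i k ik im km; rewrite /adj (negbTE ik).
  by rewrite GH // => l _ /edge_eq [[e _]|[_ e]]; [move: im|move: km]; rewrite e eqxx.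
apply: exp_le; rewrite sum_off_diagonal_const.
have : 0 <= p * (2 * t ^ 2) by apply: Rmult_le_pos; [lra|have := pow2_ge_0 t; lra].
by lra.
Qed.

Definition cut (S : {set 'I_n}) (e : 'I_n * 'I_n) : bool := (e.1 \in S) && (e.2 \notin S).

Lemma cut_mgf (S : {set 'I_n}) (t : R) : 0 <= t <= 1 ->
  expect (edge_prob p) (fun G => exp (\sum_(e | cut S e) (- t) * (adj G e.1 e.2 - p))) <=
  exp (\sum_(e | cut S e) p * (2 * t ^ 2)).
Proof.
move=> t01; apply: (@adj_mgf _ (cut S) id (fun _ _ => - t)) => //.
- by case=> i j /= /andP[/= iS]; apply: contraNneq => <-.
- move=> [i j] [k l] /andP[/= iS jS] /andP[/= kS lS] /edge_eq /= [[-> ->]//|[il _]].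
  by rewrite -il iS in lS.
- by move=> *; rewrite Rabs_Ropp Rabs_right; lra.
Qed.

(** Each of the [L] comparisons of [i] with [j] enters with weight [u * c j / INR L] up to sign;
    adding [L] squares leaves one factor [/ INR L]. *)
Lemma noise_mgf (i : 'I_n) (c : 'I_n -> R) (u : R) :
  expect (@comp_prob n L w) (fun Y => exp (\sum_j u * c j * noise w Y i j)) <=
  exp (2 * u ^ 2 / INR L * \sum_j c j ^ 2).
Proof.
have L0 : INR L <> 0 by apply/not_0_INR/eqP; rewrite -lt0n.
have Lp : 0 < INR L by have := pos_INR L; lra.
pose P (x : 'I_n * 'I_L) := x.1 != i.
pose phi (x : 'I_n * 'I_L) := (edge i x.1, x.2).
pose s (x : 'I_n * 'I_L) (Y : {ffun ('I_n * 'I_n) * 'I_L -> bool}) :=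
  u * c x.1 * / INR L * pair_sign i x.1.
pose v (x : 'I_n * 'I_L) := 2 * (u * c x.1 / INR L) ^ 2.
have uphi : uniq (map phi (enum P)).
  rewrite map_inj_in_uniq ?enum_uniq // => -[j l] [k l']; rewrite !mem_enum /phi /= => ji ki.
  by move=> [/edge_eq [[_ ->]|[<- ->]] ->].
have h := @expect_exp_sum_le _ _ comp_prob01 _ (enum P) phi s v uphi (fun j x y _ _ => erefl).
apply: (Rle_trans _ (exp (\sum_(x <- enum P) v x))); last first.
  apply: exp_le; rewrite big_enum /=.
  apply: (Rle_trans _ (\sum_x v x)).
    rewrite [X in _ <= X](bigID P) /= -[X in X <= _]Rplus_0_r; apply: Rplus_le_compat_l.
    by apply: sumR_ge0 => x _; rewrite /v; have := pow2_ge_0 (u * c x.1 / INR L); lra.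
  have -> : \sum_x v x = \sum_j \sum_(l : 'I_L) v (j, l).
    by rewrite pair_big; apply: eq_bigr => -[].
  rewrite -sumR_mull.
  apply: sumR_le => j _; rewrite (eq_bigr (fun=> 2 * (u * c j / INR L) ^ 2)) //.
  by rewrite sumR_const card_ord; right; field.
apply: Rle_trans (h _); last first.
  move=> [j l] Y _; apply: Rle_trans (bern_mgf _ _) _; first exact: comp_prob01.
  apply: exp_le; rewrite /s /v /= /pair_sign.
  have := pow2_ge_0 (u * c j / INR L).
  have e x : (u * c j * / INR L * x) ^ 2 = (u * c j / INR L) ^ 2 * x ^ 2 by rewrite /Rdiv; ring.
  by rewrite e; case: ifP => _; [|case: ifP => _]; lra.
apply: expect_le => [|Y]; first exact: comp_prob01.
apply: exp_le; right; rewrite big_enum /=.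
rewrite (bigD1 i) //= {1}/noise {1}/pair_sign ltnn Rmult_0_l !Rmult_0_r Rplus_0_l.
have -> : \sum_(x | P x) s x Y * (bit (Y (phi x)) - comp_prob w (phi x)) =
   \sum_(j | j != i) \sum_(l : 'I_L) s (j, l) Y * (bit (Y (phi (j, l))) - comp_prob w (phi (j, l))).
  by rewrite pair_big; apply: eq_big => [[j l]|[j l] _] //=; rewrite andbT.
apply: eq_bigr => j ji; rewrite /noise /s /phi /= -!sumR_mull; apply: eq_bigr => l _.
by rewrite /comp_prob /= edge_lt 1?eq_sym //; ring.
Qed.

End Mgf.

(** Markov's inequality: [1 - F] is pointwise at most the indicator of [E]. *)
Lemma prob_ge n L p w (E : outcome n L -> Prop) (F : outcome n L -> R) (delta : R) :
  0 <= p <= 1 -> (forall i, (i < n)%N -> 0 < w i) ->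
  (forall om, 0 <= F om) -> (forall om, F om < 1 -> E om) ->
  expect (@edge_prob n p) (fun G => expect (@comp_prob n L w) (fun Y => F (G, Y))) <= delta ->
  prob p w E >= 1 - delta.
Proof.
move=> p01 w0 F0 FE Fd; apply: Rle_ge.
have weightF (f : outcome n L -> R) : \sum_om weight p w om * f om =
    expect (@edge_prob n p) (fun G => expect (@comp_prob n L w) (fun Y => f (G, Y))).
  rewrite /expect; under [RHS]eq_bigr => G _ do rewrite -sumR_mull.
  rewrite pair_big; apply: eq_bigr => -[G Y] _ /=; rewrite weight_mass /=; ring.
have low : \sum_om weight p w om * (1 - F om) <= prob p w E.
  apply: sumR_le => om _.
  have W0 : 0 <= weight p w om.
    by rewrite weight_mass; apply: Rmult_le_pos; apply: mass_ge0 => e;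
      [exact: edge_prob01|exact: comp_prob01].
  case: excluded_middle_informative => [hE|nE] /=; first by have := F0 om; nra.
  case: (Rlt_dec (F om) 1) => [/FE //|F1]; by nra.
apply: Rle_trans low; rewrite weightF.
have one : expect (@edge_prob n p) (fun G => expect (@comp_prob n L w) (fun _ => 1)) = 1.
  by rewrite !expect_const.
have sub : expect (@edge_prob n p) (fun G => expect (@comp_prob n L w) (fun Y => 1 - F (G, Y))) +
   expect (@edge_prob n p) (fun G => expect (@comp_prob n L w) (fun Y => F (G, Y))) = 1.
  rewrite -[RHS]one -expect_add; congr expect; apply: functional_extensionality => G.
  by rewrite -expect_add; congr expect; apply: functional_extensionality => Y; ring.
lra.
Qed.

Lemma exp_lt1_neg x : exp x < 1 -> x < 0.
Proof. by rewrite -{1}exp_0 => /exp_lt_inv. Qed.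

Lemma sum_exp_lt1 (K : finType) (P : pred K) (f : K -> R) k :
  \sum_(k | P k) exp (f k) < 1 -> P k -> f k < 0.
Proof.
move=> lt1 Pk; apply: exp_lt1_neg; apply: Rle_lt_trans lt1.
rewrite (bigD1 k) //= -[X in X <= _]Rplus_0_r; apply: Rplus_le_compat_l.
by apply: sumR_ge0 => i _; apply/Rlt_le/exp_pos.
Qed.

Lemma sumR_const_in (I : finType) (A : {set I}) (x : R) : \sum_(i in A) x = INR #|A| * x.
Proof.
rewrite big_const; elim: #|A| => [|k IH]; first by rewrite /= Rmult_0_l.
by rewrite iterS IH S_INR; ring.
Qed.

Lemma sum_cut_const n (S : {set 'I_n}) (x : R) :
  \sum_(e | cut S e) x = INR #|S| * (INR n - INR #|S|) * x.
Proof.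
have -> : \sum_(e | cut S e) x = \sum_(i in S) \sum_(j in ~: S) x.
  by rewrite pair_big; apply: eq_bigl => -[i j]; rewrite /cut /= in_setC.
rewrite !sumR_const_in; have <- : INR #|S| + INR #|~: S| = INR n.
  by rewrite -plus_INR -[(_ + _)%coq_nat]/(#|S| + #|~: S|)%N cardsC card_ord.
by ring.
Qed.

Lemma total_variation_ind n (a : 'I_n -> 'I_n -> R) (S : {set 'I_n}) :
  (forall i j, a i j = a j i) ->
  \sum_i \sum_j a i j * Rabs (indic S i - indic S j) = 2 * \sum_(e | cut S e) a e.1 e.2.
Proof.
move=> asym; pose g i j := if cut S (i, j) then a i j else 0.
have -> : \sum_(e | cut S e) a e.1 e.2 = \sum_i \sum_j g i j.
  by rewrite pair_big big_mkcond; apply: eq_bigr => -[].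
rewrite [in RHS]sum_swap_half -Rmult_assoc Rinv_r ?Rmult_1_l; last lra.
apply: eq_bigr => i _; apply: eq_bigr => j _.
rewrite /g /cut /indic (asym j i) /=.
by case: (i \in S); case: (j \in S) => /=; split_Rabs; lra.
Qed.

(** The centered scores sum to zero, so each is the average of its differences with all of them. *)
Lemma center_abs_le n (w : nat -> R) K : (0 < n)%N ->
  (forall i j : 'I_n, Rabs (center w i - center w j) <= K) ->
  forall i : 'I_n, Rabs (center w i) <= K.
Proof.
move=> n0 hK i; have nR : 0 < INR n by apply/lt_0_INR/ltP.
apply: (Rmult_le_reg_l (INR n)) => //.
have -> : INR n * Rabs (center w i) = Rabs (\sum_(j < n) (center w i - center w j)).
  rewrite sumR_sub sumR_const card_ord sum_center // Rminus_0_r Rabs_mult.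
  by rewrite (Rabs_right (INR n)) //; lra.
apply: Rle_trans (sumR_abs _ _ _) _; rewrite -[n in INR n]card_ord -sumR_const.
exact: sumR_le.
Qed.

(** * The good event *)

Definition sgn (s : bool) : R := if s then 1 else - 1.

Lemma abs_lt_of_sgn x y : (forall s, sgn s * x < y) -> Rabs x <= y.
Proof. by move=> h; have := h true; have := h false; rewrite /sgn; split_Rabs; lra. Qed.

Lemma expect_exp_shift (I : finType) (q : I -> R) (f : {ffun I -> bool} -> R) (k c k' : R) :
  expect q (fun x => exp (f x)) <= exp k -> k - c <= k' ->
  expect q (fun x => exp (f x - c)) <= exp k'.
Proof.
move=> h kc; apply: Rle_trans (exp_le kc); rewrite /Rminus exp_plus.
have -> : (fun x => exp (f x + - c)) = (fun x => exp (- c) * exp (f x)).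
  by apply: functional_extensionality => x; rewrite exp_plus; ring.
by rewrite expect_scale Rmult_comm; apply: Rmult_le_compat_r => //; apply/Rlt_le/exp_pos.
Qed.

Section Model.
Variables (n L : nat) (p kap c lam : R) (w : nat -> R).
Hypotheses (n_ge2 : (2 <= n)%N) (L_gt0 : (0 < L)%N) (w_gt0 : forall i, (i < n)%N -> 0 < w i).
Hypotheses (kap_gt1 : 1 < kap) (c_gt0 : 0 < c) (p_le1 : p <= 1).
Hypothesis center_diff : forall i j : 'I_n, Rabs (center w i - center w j) <= ln kap.
Hypothesis p_ge : err_const c ^ 2 * kap ^ 4 * ln (INR n) / INR n <= p.

(** Up to constants, [N] is the mean degree, [q] the relative fluctuation of a degree, [eps] the
    target rate and [z] the fluctuation of one averaged comparison, the last three holding uniformly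
    through the logarithm. *)
Let ll := ln (INR n).
Let N := INR n * p.
Let q := sqrt (ll / N).
Let eps := sqrt (ll / (N * INR L)).
Let z := sqrt (ll / INR L).
Hypothesis lam_eq : lam = c * (1 / ln kap) * sqrt (N * ll / INR L).

Lemma n_ge2R : 2 <= INR n.
Proof. by have -> : 2 = INR 2 by []; apply/le_INR/leP. Qed.
Let n2 := n_ge2R.

Lemma ln_n_ge : / 2 <= ll.
Proof.
apply: Rlt_le; apply: Rlt_le_trans ln_lt_2 _; rewrite /ll.
by case: n2 => [h|<-]; [apply/Rlt_le/ln_increasing => //; lra|lra].
Qed.

Lemma L_ge1R : 1 <= INR L.
Proof. by have -> : 1 = INR 1 by []; apply/le_INR/leP. Qed.

Lemma err_const_ge : 5124096 <= err_const c.
Proof. by rewrite /err_const; lra. Qed.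

Let C0 := err_const_ge.
Let ll2 := ln_n_ge.
Let L1 := L_ge1R.

Lemma scaled_p_ge : err_const c ^ 2 * kap ^ 4 * ll <= N.
Proof.
have := Rmult_le_compat_l (INR n) _ _ ltac:(lra) p_ge.
by rewrite /N; have -> : INR n * (err_const c ^ 2 * kap ^ 4 * ln (INR n) / INR n) =
  err_const c ^ 2 * kap ^ 4 * ll by rewrite /ll; field; lra.
Qed.

Lemma kap4_ge1 : 1 <= kap ^ 4.
Proof. by apply: pow_R1_Rle; lra. Qed.

Lemma N_gt0 : 0 < N.
Proof.
apply: Rlt_le_trans scaled_p_ge; have := kap4_ge1 => k4.
by repeat apply: Rmult_lt_0_compat; rewrite ?/pow; lra.
Qed.
Let Npos := N_gt0.

Lemma p_gt0 : 0 < p.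
Proof. by apply: (Rmult_lt_reg_l (INR n)); rewrite -/N; lra. Qed.
Let ppos := p_gt0.

Lemma q_sq : N * q ^ 2 = ll.
Proof. rewrite pow2_sqrt; first by field; lra. by apply/Rlt_le/Rdiv_lt_0_compat; lra. Qed.

Lemma eps_sq : N * INR L * eps ^ 2 = ll.
Proof.
have NL : 0 < N * INR L by apply: Rmult_lt_0_compat; lra.
by rewrite pow2_sqrt; [field; lra|apply/Rlt_le/Rdiv_lt_0_compat; lra].
Qed.

Lemma z_sq : INR L * z ^ 2 = ll.
Proof. by rewrite pow2_sqrt; [field; lra|apply/Rlt_le/Rdiv_lt_0_compat; lra]. Qed.

Let q0 : 0 <= q := sqrt_pos _.
Let e0 : 0 <= eps := sqrt_pos _.
Let z0 : 0 <= z := sqrt_pos _.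

Lemma q_gt0 : 0 < q.
Proof. by case: q0 => // e; have := q_sq; rewrite -e; lra. Qed.

Lemma eps_gt0 : 0 < eps.
Proof. by case: e0 => // e; have := eps_sq; rewrite -e; lra. Qed.

Lemma z_gt0 : 0 < z.
Proof. by case: z0 => // e; have := z_sq; rewrite -e; lra. Qed.

Lemma eps_le_q : eps <= q.
Proof.
apply: sqrt_le_1_alt; apply: Rmult_le_compat_l; first lra.
by apply: Rinv_le_contravar => //; nra.
Qed.

(** Squared, this is the lower bound on [p], which explains the constant [err_const c ^ 2] there. *)
Lemma kap_q_small : kap ^ 2 * q * err_const c <= 1.
Proof.
apply: Rsqr_incr_0_var; last lra.
rewrite !Rsqr_pow2 pow1; apply: (Rmult_le_reg_l ll); first lra.
rewrite Rmult_1_r; apply: (Rle_trans _ (err_const c ^ 2 * kap ^ 4 * ll * q ^ 2)).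
  by right; ring.
by rewrite -[X in _ <= X]q_sq; apply: Rmult_le_compat_r; [apply: pow2_ge_0|exact: scaled_p_ge].
Qed.

Lemma q_small : 5124096 * q <= 1.
Proof.
have := kap_q_small; have : 1 <= kap ^ 2 by apply: pow_R1_Rle; lra.
have : 0 <= q * err_const c by apply: Rmult_le_pos; lra.
by nra.
Qed.

Lemma n_large : err_const c ^ 2 * kap ^ 4 <= 2 * INR n.
Proof.
have h := scaled_p_ge; have : N <= INR n by rewrite /N; nra.
have : 0 <= err_const c ^ 2 * kap ^ 4 by apply: Rmult_le_pos; [apply: pow2_ge_0|have := kap4_ge1; lra].
by nra.
Qed.

Let lnk : 0 < ln kap.
Proof. by rewrite -ln_1; apply: ln_increasing; lra. Qed.

(** The choice of [lam] gives the regularization bias [lam * ln kap] the order of the row noise. *)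
Lemma lam_scaled : lam * ln kap = c * (N * eps).
Proof.
rewrite lam_eq; have -> : N * ll / INR L = (N * eps) ^ 2.
  by rewrite -eps_sq; field; lra.
by rewrite sqrt_pow2; [field; lra|apply: Rmult_le_pos; lra].
Qed.

Lemma lam_gt0 : 0 < lam.
Proof.
apply: (Rmult_lt_reg_r (ln kap)) => //; rewrite lam_scaled Rmult_0_l.
by apply: Rmult_lt_0_compat => //; apply: Rmult_lt_0_compat => //; exact: eps_gt0.
Qed.
Let lam0 := lam_gt0.

Let mu := / (36 * kap).
Let b : 'I_n -> R := fun i => center w i.
Let h i j := sigm_ext mu (b i - b j).

Lemma mu_gt0 : 0 < mu.
Proof. by apply: Rinv_0_lt_compat; lra. Qed.
Let mupos := mu_gt0.

(** On [[-2, 2]] the logistic slope is at least [exp (- (ln kap + 2)) / 4], and [exp 2 <= 9] brings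
    this above [/ (36 * kap)]. *)
Lemma h_slopes : slopes_in mu (/ 4) h.
Proof.
move=> i j x y; apply: (sigm_ext_slope (b := ln kap)); first exact: center_diff.
  rewrite exp_Ropp exp_plus exp_ln; last lra.
  have e9 : exp 2 <= 9.
    have -> : 2 = 1 + 1 by ring.
    by rewrite exp_plus; have := exp_le_3; have := exp_pos 1; nra.
  have ep := exp_pos 2; have kp : 0 < kap * exp 2 by nra.
  have -> : / (kap * exp 2) / 4 = / (4 * (kap * exp 2)) by field; lra.
  by apply: Rinv_le_contravar; nra.
by apply: Rinv_le_contravar; lra.
Qed.

Lemma h_at0 i j : h i j 0 = 0.
Proof. exact: sigm_ext0. Qed.

Lemma h_opp i j x : h j i (- x) = - h i j x.
Proof. by rewrite /h -sigm_ext_opp Ropp_minus_distr. Qed.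

(** The choice by [epsilon] makes the solution a function of [a] and [r] alone, so it inherits their
    independence of row [m]. *)
Definition solution (a : 'I_n -> 'I_n -> R) (r : 'I_n -> R) : 'I_n -> R :=
  epsilon (inhabits (fun _ => 0)) (fun x => forall i, score_map a h lam x i = r i).

Lemma solutionP a r i : (forall i j, 0 <= a i j) -> score_map a h lam (solution a r) i = r i.
Proof.
move=> a0; move: i; apply: (epsilon_spec (inhabits (fun _ => 0))
  (fun x => forall i, score_map a h lam x i = r i)).
apply: (@field_surjective _ _ _ _ (/ 4)) => // [|i j x y yx|i j]; first lra; last exact: h_at0.
have : 0 <= mu * (x - y) by apply: Rmult_le_pos; lra.
by have := h_slopes i j yx; lra.
Qed.

Local Notation graph := {ffun 'I_n * 'I_n -> bool}.
Local Notation comps := {ffun ('I_n * 'I_n) * 'I_L -> bool}.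
Implicit Types (G : graph) (Y : comps).

Definition mle_err G Y : 'I_n -> R :=
  solution (adj G) (full_rhs (adj G) (noise w Y) b lam).

Definition loo_err (m : 'I_n) G Y : 'I_n -> R :=
  solution (loo_adj (adj G) p m) (loo_rhs (adj G) (noise w Y) b lam m).

(** Normalizing by the sup norm gives coefficients of size at most 1, as the Chernoff bound needs;
    if the norm is 0, the convention [/ 0 = 0] makes them 0. *)
Definition loo_coef (m j : 'I_n) G Y : R :=
  h m j (loo_err m G Y m - loo_err m G Y j) / supnorm (loo_err m G Y).

(* Each exponent has exponential moment at most exp (- 8 ln n) (its |S|-th power
   for [cut_exponent]) and is negative only when its deviation bound holds. *)
Definition cut_exponent (S : {set 'I_n}) G : R :=
  \sum_(e | cut S e) (- / 8) * (adj G e.1 e.2 - p) -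
  (\sum_(e | cut S e) p * (2 * (/ 8) ^ 2) + 8 * INR #|S| * ll).

Definition deg_exponent (m : 'I_n) G : R :=
  \sum_(j | j != m) q * (adj G m j - p) - 10 * ll.

Definition row_exponent (t : 'I_n * bool) G Y : R :=
  \sum_j (sgn t.2 * (INR L * eps)) * adj G t.1 j * noise w Y t.1 j -
  (2 * (INR L * eps) ^ 2 / INR L * \sum_j adj G t.1 j ^ 2 + 8 * ll).

Definition pair_exponent (t : ('I_n * 'I_n) * bool) Y : R :=
  \sum_k (sgn t.2 * (INR L * z)) * bit (k == t.1.2) * noise w Y t.1.1 k - 10 * ll.

Definition loo_exponent (t : 'I_n * bool) G Y : R :=
  \sum_(j | j != t.1) (sgn t.2 * q * loo_coef t.1 j G Y) * (adj G t.1 j - p) - 10 * ll.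

Definition chernoff_sum (om : outcome n L) : R :=
  \sum_(S | S != set0) exp (cut_exponent S om.1) + \sum_m exp (deg_exponent m om.1) +
  \sum_t exp (row_exponent t om.1 om.2) + \sum_t exp (pair_exponent t om.2) +
  \sum_t exp (loo_exponent t om.1 om.2).

Let p01 : 0 <= p <= 1.
Proof. by lra. Qed.

Lemma loo_adj_ge0 G m i j : 0 <= loo_adj (adj G) p m i j.
Proof.
rewrite /loo_adj; case: ifP => _; first lra; case: ifP => _; first lra.
by case: (adj01 G i j) => ->; lra.
Qed.

(** The independence behind leave-one-out: no edge at [m] influences [loo_err m]. *)
Lemma loo_err_inv m G H Y :
  (forall i k, i != k -> i != m -> k != m -> adj G i k = adj H i k) ->
  loo_err m G Y = loo_err m H Y.
Proof.
move=> GH; have GH' i j : (i == m) || (j == m) = false -> adj G i j = adj H i j.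
  by move=> /norP[im jm]; case: (altP (i =P j)) => [->|ij]; [rewrite !adj_diag|exact: GH].
rewrite /loo_err; congr solution; apply: functional_extensionality => i.
  apply: functional_extensionality => j; rewrite /loo_adj.
  by case: ifP => // _; case: ifP => // /GH'.
rewrite /loo_rhs; congr (_ - _); apply: eq_bigr => j _.
by case: ifP => // /GH' ->.
Qed.

Lemma loo_coef_le1 m j G Y : Rabs (loo_coef m j G Y) <= 1.
Proof.
rewrite /loo_coef; set d := loo_err m G Y.
have B0 := supnorm_ge0 d.
have hb : Rabs (h m j (d m - d j)) <= supnorm d / 2.
  apply: Rle_trans (slopes_abs_le _ (Rlt_le _ _ mupos) h_slopes (h_at0 m j)) _.
  by have := le_supnorm d m; have := le_supnorm d j; split_Rabs; lra.
case: B0 => [B0|<-]; last by rewrite /Rdiv Rinv_0 Rmult_0_r Rabs_R0; lra.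
rewrite /Rdiv Rabs_mult Rabs_inv (Rabs_right (supnorm d)); last lra.
by apply: (Rmult_le_reg_r (supnorm d)) => //; rewrite Rmult_assoc Rinv_l; lra.
Qed.

Lemma sgn_abs s x : Rabs (sgn s * x) = Rabs x.
Proof. by case: s; rewrite /sgn ?Rmult_1_l // Ropp_mult_distr_l_reverse Rmult_1_l Rabs_Ropp. Qed.

Lemma sgn_sq s : sgn s ^ 2 = 1.
Proof. by case: s; rewrite /sgn; ring. Qed.

Lemma expect_cut S : expect (@edge_prob n p) (fun G => exp (cut_exponent S G)) <= exp (- (8 * ll)) ^ #|S|.
Proof.
apply: Rle_trans (expect_exp_shift (cut_mgf p01 (t := / 8) S _) (Rle_refl _)) _; first lra.
have -> : forall k : nat, exp (- (8 * ll)) ^ k = exp (- (8 * INR k * ll)).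
  elim=> [|k IH]; first by rewrite Rmult_0_r Rmult_0_l Ropp_0 exp_0.
  by rewrite S_INR -[_ ^ _.+1]/(_ * _ ^ k) IH -exp_plus; congr exp; ring.
by apply: exp_le; right; ring.
Qed.

Let q1 : 0 <= q <= 1.
Proof. by have := q_small; lra. Qed.

Lemma expect_deg m : expect (@edge_prob n p) (fun G => exp (deg_exponent m G)) <= exp (- (8 * ll)).
Proof.
apply: (expect_exp_shift (row_mgf p01 (t := q) _ _ _)) => //.
  by move=> j G _; rewrite Rabs_right; lra.
by rewrite -/N; have := q_sq; lra.
Qed.

Lemma expect_loo t Y : expect (@edge_prob n p) (fun G => exp (loo_exponent t G Y)) <= exp (- (8 * ll)).
Proof.
case: t => m s; apply: (expect_exp_shift (row_mgf p01 (t := q) _ _ _)) => //=.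
- move=> j G _; rewrite Rmult_assoc sgn_abs Rabs_mult (Rabs_right q); last lra.
  by have := loo_coef_le1 m j G Y; have := Rabs_pos (loo_coef m j G Y); nra.
- by move=> j G H _ /(loo_err_inv Y) e; rewrite /loo_coef e.
by rewrite -/N; have := q_sq; lra.
Qed.

Lemma expect_row t G : expect (@comp_prob n L w) (fun Y => exp (row_exponent t G Y)) <= exp (- (8 * ll)).
Proof.
case: t => i s; apply: (expect_exp_shift (noise_mgf w_gt0 L_gt0 _ _ _)) => /=.
rewrite (_ : (sgn s * (INR L * eps)) ^ 2 = (INR L * eps) ^ 2); first lra.
by rewrite Rpow_mult_distr sgn_sq; ring.
Qed.

Lemma expect_pair t : expect (@comp_prob n L w) (fun Y => exp (pair_exponent t Y)) <= exp (- (8 * ll)).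
Proof.
case: t => -[i j] s; apply: (expect_exp_shift (noise_mgf w_gt0 L_gt0 _ _ _)) => /=.
have -> : \sum_(k : 'I_n) bit (k == j) ^ 2 = 1.
  rewrite (bigD1 j) //= eqxx big1 => [|k /negbTE ->]; rewrite /bit; last ring.
  by ring.
rewrite Rpow_mult_distr sgn_sq.
have -> : 2 * (1 * (INR L * z) ^ 2) / INR L * 1 = 2 * (INR L * z ^ 2) by field; lra.
by rewrite z_sq; lra.
Qed.

Lemma exp_ln_n : exp (- (8 * ll)) = / INR n ^ 8.
Proof.
rewrite exp_Ropp; congr (/ _).
have -> : 8 * ll = INR 8 * ll by rewrite /=; ring.
by rewrite -Rpower_pow //; lra.
Qed.

Lemma expect_chernoff_sum :
  expect (@edge_prob n p) (fun G => expect (@comp_prob n L w) (fun Y => chernoff_sum (G, Y))) <=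
  10 / INR n ^ 5.
Proof.
pose u := exp (- (8 * ll)); have u0 : 0 < u by exact: exp_pos.
have ge0 := edge_prob01 (n := n) p01; have cp0 := @comp_prob01 n L w w_gt0.
have -> : (fun G => expect (@comp_prob n L w) (fun Y => chernoff_sum (G, Y))) = (fun G =>
    \sum_(S | S != set0) exp (cut_exponent S G) + \sum_m exp (deg_exponent m G) +
    expect (@comp_prob n L w) (fun Y => \sum_t exp (row_exponent t G Y)) +
    expect (@comp_prob n L w) (fun Y => \sum_t exp (pair_exponent t Y)) +
    expect (@comp_prob n L w) (fun Y => \sum_t exp (loo_exponent t G Y))).
  apply: functional_extensionality => G; rewrite /chernoff_sum /=.
  by rewrite !expect_add !expect_const.
rewrite !expect_add.
have b1 : expect (@edge_prob n p) (fun G => \sum_(S | S != set0) exp (cut_exponent S G)) <=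
    3 * (INR n * u).
  rewrite expect_sum.
  apply: Rle_trans (sum_pow_card_nonempty _ _); first by apply: sumR_le => S _; exact: expect_cut.
    by apply: Rlt_le.
  rewrite /u exp_ln_n; apply: (Rmult_le_reg_r (INR n ^ 8)); first by apply: pow_lt; lra.
  rewrite Rmult_assoc Rinv_l; last by apply: pow_nonzero; lra.
  have := pow_R1_Rle (INR n) 7 ltac:(lra); rewrite -[INR n ^ 8]/(INR n * INR n ^ 7); nra.
have b2 : expect (@edge_prob n p) (fun G => \sum_m exp (deg_exponent m G)) <= INR n * u.
  rewrite expect_sum -[in X in _ <= X](card_ord n) -sumR_const.
  by apply: sumR_le => m _; exact: expect_deg.
have b3 : expect (@edge_prob n p) (fun G => expect (@comp_prob n L w)
    (fun Y => \sum_t exp (row_exponent t G Y))) <= INR n * 2 * u.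
  rewrite -[X in _ <= X](expect_const (@edge_prob n p)); apply: expect_le => // G.
  rewrite expect_sum; have := sumR_const ('I_n * bool)%type u.
  rewrite card_prod card_ord card_bool mult_INR => <-.
  by apply: sumR_le => t _; exact: expect_row.
have b4 : expect (@edge_prob n p) (fun G => expect (@comp_prob n L w)
    (fun Y => \sum_t exp (pair_exponent t Y))) <= INR n * INR n * 2 * u.
  rewrite expect_const expect_sum; have := sumR_const (('I_n * 'I_n) * bool)%type u.
  rewrite !card_prod !card_ord card_bool !mult_INR => <-.
  by apply: sumR_le => t _; exact: expect_pair.
have b5 : expect (@edge_prob n p) (fun G => expect (@comp_prob n L w)
    (fun Y => \sum_t exp (loo_exponent t G Y))) <= INR n * 2 * u.
  (* The leave-one-out exponents are averaged over the graph with the comparisons held fixed. *)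
  rewrite (expect_exchange _ _ (fun G Y => \sum_t exp (loo_exponent t G Y))).
  rewrite -[X in _ <= X](expect_const (@comp_prob n L w)); apply: expect_le => // Y.
  rewrite expect_sum; have := sumR_const ('I_n * bool)%type u.
  rewrite card_prod card_ord card_bool mult_INR => <-.
  by apply: sumR_le => t _; exact: expect_loo.
apply: (Rle_trans _ (3 * (INR n * u) + INR n * u + INR n * 2 * u + INR n * INR n * 2 * u + INR n * 2 * u)).
  by repeat apply: Rplus_le_compat.
(* The union bound counts [8 n + 2 n ^ 2 <= 10 n ^ 2] terms of weight [u]. *)
have nn : INR n * u <= INR n * INR n * u by apply: Rmult_le_compat_r; [lra|nra].
apply: (Rle_trans _ (10 * (INR n ^ 2 * u))).
  by rewrite -[INR n ^ 2]/(INR n * (INR n * 1)) Rmult_1_r; lra.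
rewrite /u exp_ln_n; apply: Rmult_le_compat_l; first lra.
apply: (Rmult_le_reg_r (INR n ^ 8)); first by apply: pow_lt; lra.
rewrite Rmult_assoc Rinv_l; last by apply: pow_nonzero; lra.
have -> : / INR n ^ 5 * INR n ^ 8 = INR n ^ 2 * INR n by field; lra.
by apply: Rmult_le_compat_l; [apply: pow2_ge_0|lra].
Qed.

(** * Deterministic consequences of the Chernoff bounds *)

Section GoodEvent.
Variables (G : graph) (Y : comps).
Hypothesis good : chernoff_sum (G, Y) < 1.

Let sum_exp_ge0 (K : finType) (P : pred K) (f : K -> R) : 0 <= \sum_(k | P k) exp (f k).
Proof. by apply: sumR_ge0 => i _; apply/Rlt_le/exp_pos. Qed.

Lemma good_exponents :
  [/\ forall S, S != set0 -> cut_exponent S G < 0, forall m, deg_exponent m G < 0,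
      forall t, row_exponent t G Y < 0, forall t, pair_exponent t Y < 0 &
      forall t, loo_exponent t G Y < 0].
Proof.
pose A1 := \sum_(S | S != set0) exp (cut_exponent S G).
pose A2 := \sum_m exp (deg_exponent m G).
pose A3 := \sum_t exp (row_exponent t G Y).
pose A4 := \sum_t exp (pair_exponent t Y).
pose A5 := \sum_t exp (loo_exponent t G Y).
have g1 : 0 <= A1 by exact: sum_exp_ge0.
have g2 : 0 <= A2 by exact: sum_exp_ge0.
have g3 : 0 <= A3 by exact: sum_exp_ge0.
have g4 : 0 <= A4 by exact: sum_exp_ge0.
have g5 : 0 <= A5 by exact: sum_exp_ge0.
have lt1 : A1 + A2 + A3 + A4 + A5 < 1 by exact: good.
have l1 : A1 < 1 by lra.
have l2 : A2 < 1 by lra.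
have l3 : A3 < 1 by lra.
have l4 : A4 < 1 by lra.
have l5 : A5 < 1 by lra.
split=> [S|m|t|t|t].
- exact: sum_exp_lt1 l1.
- exact: sum_exp_lt1 l2 isT.
- exact: sum_exp_lt1 l3 isT.
- exact: sum_exp_lt1 l4 isT.
- exact: sum_exp_lt1 l5 isT.
Qed.

(** Dividing the exponent by [q] bounds the excess degree by [10 * (N * q)], which [q_small] keeps
    below [N]. *)
Lemma good_deg i : \sum_j adj G i j <= 2 * (INR n * p).
Proof.
have [_ /(_ i) + _ _ _] := good_exponents.
rewrite /deg_exponent sumR_mull sumR_sub sum_off_diagonal_const.
have -> : \sum_j adj G i j = \sum_(j | j != i) adj G i j.
  by rewrite (bigD1 i) //= adj_diag Rplus_0_l.
rewrite -/N; set s := \sum_(j | _) _ => lt0.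
have e : (INR n - 1) * p = N - p by rewrite /N; ring.
rewrite e in lt0; have hq : q * (s - (N - p)) <= q * (10 * (N * q)).
  by have := q_sq; rewrite -[q ^ 2]/(q * (q * 1)); lra.
have := Rmult_le_reg_l _ _ _ q_gt0 hq.
have := Rmult_le_compat_l _ _ _ (Rlt_le _ _ Npos) q_small.
have := Rmult_le_pos _ _ (Rlt_le _ _ Npos) q0.
by lra.
Qed.

Lemma good_row i : Rabs (\sum_j adj G i j * noise w Y i j) <= 12 * (N * eps).
Proof.
have [_ _ hr _ _] := good_exponents.
set T := \sum_j _; apply: abs_lt_of_sgn => s; have := hr (i, s); rewrite /row_exponent /=.
have -> : \sum_j sgn s * (INR L * eps) * adj G i j * noise w Y i j = INR L * eps * (sgn s * T).
  by rewrite -!sumR_mull; apply: eq_bigr => j _; ring.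
have -> : \sum_j adj G i j ^ 2 = \sum_j adj G i j.
  by apply: eq_bigr => j _; case: (adj01 G i j) => ->; rewrite /pow; ring.
have Le : 0 < INR L * eps by apply: Rmult_lt_0_compat; [lra|exact: eps_gt0].
have -> : 2 * (INR L * eps) ^ 2 / INR L = 2 * (INR L * eps ^ 2) by field; lra.
have := Rmult_le_compat_l (2 * (INR L * eps ^ 2)) _ _ _ (good_deg i).
have Le2 : 0 <= 2 * (INR L * eps ^ 2).
  by have := pow2_ge_0 eps => ?; apply: Rmult_le_pos; [lra|apply: Rmult_le_pos; lra].
move=> /(_ Le2); rewrite -/N => hd lt0.
have es := eps_sq; apply: (Rmult_lt_reg_l _ _ _ Le).
have -> : INR L * eps * (12 * (N * eps)) = 12 * (N * INR L * eps ^ 2) by ring.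
by lra.
Qed.

Lemma good_pair i j : Rabs (noise w Y i j) <= 10 * z.
Proof.
have [_ _ _ hp _] := good_exponents.
apply: abs_lt_of_sgn => s; have := hp ((i, j), s); rewrite /pair_exponent /=.
rewrite (bigD1 j) //= eqxx big1 ?Rplus_0_r => [|k /negbTE ->]; rewrite /bit; last ring.
have Lz : 0 < INR L * z by apply: Rmult_lt_0_compat; [lra|exact: z_gt0].
have zs := z_sq => lt0; apply: (Rmult_lt_reg_l _ _ _ Lz).
have -> : INR L * z * (10 * z) = 10 * (INR L * z ^ 2) by ring.
by lra.
Qed.

Lemma good_loo m : Rabs (\sum_(j | j != m) (adj G m j - p) *
    h m j (loo_err m G Y m - loo_err m G Y j)) <= 10 * (N * q * supnorm (loo_err m G Y)).
Proof.
have [_ _ _ _ hl] := good_exponents.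
set d := loo_err m G Y; have B0 := supnorm_ge0 d.
have hE j : h m j (d m - d j) = supnorm d * loo_coef m j G Y.
  case: B0 => [B0|e]; first by rewrite /loo_coef -/d; field; lra.
  have dz k : d k = 0 by have := le_supnorm d k; rewrite -e; split_Rabs; lra.
  by rewrite -e !dz Rminus_diag h_at0; ring.
have key : Rabs (\sum_(j | j != m) (adj G m j - p) * loo_coef m j G Y) <= 10 * (N * q).
  set T := \sum_(j | _) _; apply: abs_lt_of_sgn => s; have := hl (m, s); rewrite /loo_exponent /=.
  have -> : \sum_(j | j != m) sgn s * q * loo_coef m j G Y * (adj G m j - p) = q * (sgn s * T).
    by rewrite -!sumR_mull; apply: eq_bigr => j _; ring.
  have qs := q_sq => lt0; apply: (Rmult_lt_reg_l _ _ _ q_gt0).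
  have -> : q * (10 * (N * q)) = 10 * (N * q ^ 2) by ring.
  by lra.
have -> : \sum_(j | j != m) (adj G m j - p) * h m j (d m - d j) =
   supnorm d * \sum_(j | j != m) (adj G m j - p) * loo_coef m j G Y.
  by rewrite -sumR_mull; apply: eq_bigr => j _; rewrite hE; ring.
rewrite Rabs_mult (Rabs_right (supnorm d)); last lra.
by have := Rmult_le_compat_l _ _ _ B0 key; lra.
Qed.

(** A set of at most half the vertices cuts at least [n |S| / 2] pairs, so the union bound penalty
    [64 * |S| * ll] is a small fraction of the mean cut. *)
Lemma good_cut_half (S : {set 'I_n}) : S != set0 -> 2 * INR #|S| <= INR n ->
  p / 4 * (\sum_(e | cut S e) 1) <= \sum_(e | cut S e) adj G e.1 e.2.
Proof.
move=> S0 half; have [/(_ S S0) + _ _ _ _] := good_exponents.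
rewrite /cut_exponent sumR_mull sumR_sub !sum_cut_const; set E := \sum_(e | _) _.
have s0 := pos_INR #|S|; set s := INR #|S| in s0 half *.
pose Q := s * (INR n - s).
have Q0 : 0 <= Q by apply: Rmult_le_pos; lra.
have pQ0 : 0 <= p * Q by apply: Rmult_le_pos; lra.
have hQ : s * INR n <= 2 * Q by rewrite /Q; nra.
have hs : s * ll <= / 1000 * (p * Q).
  rewrite -q_sq; have -> : s * (N * q ^ 2) = s * INR n * (p * q ^ 2) by rewrite /N; ring.
  have pq : 0 <= p * q ^ 2 by apply: Rmult_le_pos; [lra|apply: pow2_ge_0].
  apply: (Rle_trans _ (2 * Q * (p * q ^ 2))); first exact: Rmult_le_compat_r.
  have q2 : q ^ 2 <= / 2000 by have := q_small; have := q0; nra.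
  by have := Rmult_le_compat_l _ _ _ pQ0 q2; lra.
have -> : s * (INR n - s) * (p * (2 * (/ 8) ^ 2)) = p * Q / 32 by rewrite /Q; field.
have -> : s * (INR n - s) * p = p * Q by rewrite /Q; ring.
have -> : s * (INR n - s) * 1 = Q by rewrite /Q; ring.
by lra.
Qed.

(** Larger sets reduce to their complements, which have the same total variation. *)
Lemma good_expansion (S : {set 'I_n}) :
  p / 4 * \sum_i \sum_j Rabs (indic S i - indic S j) <=
  \sum_i \sum_j adj G i j * Rabs (indic S i - indic S j).
Proof.
have half (A : {set 'I_n}) : 2 * INR #|A| <= INR n ->
    p / 4 * \sum_i \sum_j Rabs (indic A i - indic A j) <=
    \sum_i \sum_j adj G i j * Rabs (indic A i - indic A j).
  have -> : \sum_i \sum_j Rabs (indic A i - indic A j) = 2 * \sum_(e | cut A e) 1.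
    rewrite -(total_variation_ind (a := fun _ _ => 1)) //.
    by apply: eq_bigr => i _; apply: eq_bigr => j _; rewrite Rmult_1_l.
  rewrite total_variation_ind; last exact: adj_sym.
  case: (altP (A =P set0)) => [->|A0 hA]; last by have := good_cut_half A0 hA; lra.
  by rewrite !big_pred0 => [_|e|e]; rewrite ?/cut ?inE //; lra.
case: (Rle_dec (2 * INR #|S|) (INR n)) => [/half //|big].
have indC i : indic (~: S) i = 1 - indic S i by rewrite /indic in_setC; case: (i \in S) => /=; ring.
have absC i j : Rabs (indic S i - indic S j) = Rabs (indic (~: S) i - indic (~: S) j).
  by rewrite !indC -Rabs_Ropp; congr Rabs; ring.
under eq_bigr => i _ do under eq_bigr => j _ do rewrite absC.
under [X in _ <= X]eq_bigr => i _ do under eq_bigr => j _ do rewrite absC.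
apply: half; have : INR #|S| + INR #|~: S| = INR n.
  by rewrite -plus_INR -[(_ + _)%coq_nat]/(#|S| + #|~: S|)%N cardsC card_ord.
by lra.
Qed.

(** Cheeger's inequality with expansion [p / 4] and degree bound [2 * N] yields
    [N / 16 * A <= 8 * E], hence the 256. *)
Lemma good_gap (x : 'I_n -> R) : \sum_i x i = 0 ->
  N / 256 * \sum_i x i ^ 2 <= / 2 * \sum_i \sum_j adj G i j * (x i - x j) ^ 2.
Proof.
have a0 i j : 0 <= adj G i j by case: (adj01 G i j) => ->; lra.
have d0 : 0 <= 2 * (INR n * p) by rewrite -/N; lra.
have p4 : 0 <= p / 4 by lra.
move=> /(cheeger_inequality a0 (adj_sym G) d0 good_deg p4 good_expansion).
rewrite -/N; have -> : (p / 4 * INR n) ^ 2 = N * (N / 16) by rewrite /N; field.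
set A := \sum_i _; set E := \sum_i \sum_j _ => hA.
have : N / 16 * A <= 8 * E by apply: (Rmult_le_reg_l N) => //; lra.
by lra.
Qed.

Lemma good_mle_err : supnorm (mle_err G Y) <= err_const c * (kap ^ 2 * eps).
Proof.
set d := mle_err G Y; set D := supnorm d.
have D0 : 0 <= D by exact: supnorm_ge0.
have a0 i j : 0 <= adj G i j by case: (adj01 G i j) => ->; lra.
have d_eq i : score_map (adj G) h lam d i = full_rhs (adj G) (noise w Y) b lam i.
  exact: solutionP.
have k2 : 0 <= kap ^ 2 * eps by apply: Rmult_le_pos => //; apply: pow2_ge_0.
have K0 : 0 <= err_const c * (kap ^ 2 * eps) by apply: Rmult_le_pos => //; lra.
(* Maximizing over [m] gives [D] at most half the claimed bound plus [2 / 7 * D]. *)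
suff key m : Rabs (d m) <= / 2 * err_const c * (kap ^ 2 * eps) + 2 / 7 * D.
  have : D <= / 2 * err_const c * (kap ^ 2 * eps) + 2 / 7 * D by apply: supnorm_le => //; lra.
  by lra.
set dm := loo_err m G Y.
have dm_eq i : score_map (loo_adj (adj G) p m) h lam dm i =
    loo_rhs (adj G) (noise w Y) b lam m i.
  by apply: solutionP => k l; exact: loo_adj_ge0.
have n0 : (0 < n)%N by apply: leq_trans n_ge2.
have bs : \sum_i b i = 0 by exact: sum_center.
have center_le := center_abs_le n0 center_diff.
have rho0 : 0 <= N * eps by apply: Rmult_le_pos; lra.
have sg0 : 0 <= N * q by apply: Rmult_le_pos; lra.
have mu0 : 0 <= mu by lra.
have z_rho : INR n * p * z ^ 2 = (N * eps) ^ 2.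
  rewrite -/N; have : z ^ 2 = N * eps ^ 2.
    by apply: (Rmult_eq_reg_l (INR L)); [rewrite z_sq -eps_sq; ring|lra].
  by move=> ->; ring.
have n_sg : INR n * p <= 2 * (N * q) ^ 2.
  rewrite -/N; have -> : 2 * (N * q) ^ 2 = 2 * (N * (N * q ^ 2)) by ring.
  by rewrite q_sq; nra.
have pair_noise i j : i != j -> Rabs (noise w Y i j) <= 10 * z by move=> _; exact: good_pair.
have dist := loo_distance (adj01 G) (adj_sym G) (adj_diag G) (noise_opp w Y) bs p01 lam0 mu0
  h_slopes h_opp h_at0 d_eq dm_eq rho0 sg0 good_gap good_deg good_row pair_noise
  z_rho n_sg (good_loo m).
have dl := l2norm_solution (adj01 G) (adj_sym G) (noise_opp w Y) bs lam0 mu0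
  h_slopes h_opp h_at0 d_eq rho0 good_gap center_le good_row (Rlt_le _ _ lnk).
have row := loo_row_value p01 lam0 mu0 h_slopes h_at0 dm_eq center_le.
set eta := l2norm (fun i => d i - dm i) in dist.
have eta0 : 0 <= eta by exact: l2norm_ge0.
have etai i : Rabs (d i - dm i) <= eta by exact: (abs_le_l2norm (fun i => d i - dm i)).
have BD : supnorm dm <= D + eta.
  apply: supnorm_le => [|i]; first lra.
  by have := le_supnorm d i; have := etai i; rewrite -/D; split_Rabs; lra.
have tri : l2norm dm <= l2norm d + eta.
  have -> : eta = l2norm (fun i => dm i - d i).
    by rewrite /eta /l2norm; congr sqrt; apply: eq_bigr => i _; ring.
  apply: Rle_trans (l2norm_triangle _ _); right; congr l2norm.
  by apply: functional_extensionality => i; ring.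
have := @bootstrap kap c eps q N (INR n) (sqrt (INR n)) p eta (supnorm dm) D (l2norm d) (Rabs (dm m))
  ltac:(lra) ltac:(lra) e0 q0 ltac:(lra) (conj ppos p_le1) erefl n2 (sqrt_pos _)
  (pow2_sqrt _ (pos_INR n)) eta0 (supnorm_ge0 _) (l2norm_ge0 _) (Rabs_pos _)
  kap_q_small n_large.
rewrite -/mu => boot; apply: Rle_trans (boot _ _ _ BD).
- by have := etai m; split_Rabs; lra.
- by [].
- by apply: Rle_trans dl _; rewrite lam_scaled; right.
apply: Rle_trans row _; rewrite lam_scaled; apply: Rplus_le_compat_l.
by apply: Rmult_le_compat_l; [lra|apply: Rmult_le_compat_l => //; exact: sqrt_pos].
Qed.

(** Errors of at most 1 keep all differences within [[-2, 2]], where the extended logistic increment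
    is the true one. *)
Lemma err_small : err_const c * (kap ^ 2 * eps) <= 1.
Proof.
apply: Rle_trans kap_q_small; have -> : kap ^ 2 * q * err_const c = err_const c * (kap ^ 2 * q) by ring.
apply: Rmult_le_compat_l; first lra.
by apply: Rmult_le_compat_l; [apply: pow2_ge_0|exact: eps_le_q].
Qed.

Lemma good_minimizer (th : 'I_n -> R) : is_minimizer (reg_loss lam (G, Y)) th ->
  forall i, Rabs (th i - center w i) <= err_const c * (kap ^ 2 * eps).
Proof.
move=> min i; set d := mle_err G Y.
have d1 k : Rabs (d k) <= 1.
  by apply: Rle_trans (le_supnorm _ _) _; apply: Rle_trans good_mle_err err_small.
have -> : th i = b i + d i; last first.
  rewrite (_ : b i + d i - center w i = d i); last by rewrite /b; ring.
  exact: Rle_trans (le_supnorm _ _) good_mle_err.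
apply: (@minimizer_unique n L w w_gt0 L_gt0 (G, Y) lam (fun k => b k + d k) th lam0 _ min i) => k /=.
have a0 u v : 0 <= adj G u v by case: (adj01 G u v) => ->; lra.
have := solutionP (full_rhs (adj G) (noise w Y) b lam) k a0.
rewrite -/(mle_err G Y) -/d /score_map /full_rhs => eqk.
have -> : \sum_j adj G k j * (sigm (b k + d k - (b j + d j)) - sigm (center w k - center w j)) =
   \sum_j adj G k j * h k j (d k - d j).
  apply: eq_bigr => j _; rewrite /h sigm_ext_eq; last first.
    by have := d1 k; have := d1 j; split_Rabs; lra.
  by congr (_ * (sigm _ - _)); ring.
by transitivity (\sum_j adj G k j * noise w Y k j); first lra.
Qed.

End GoodEvent.
End Model.

(** * From the sup norm bound to the theorem *)

Lemma center_diff_le n (w : nat -> R) wmin wmax : 0 < wmin ->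
  (forall i, (i < n)%N -> wmin <= w i <= wmax) ->
  forall i j : 'I_n, Rabs (center w i - center w j) <= ln (wmax / wmin).
Proof.
move=> wm hw i j; have hi := hw i (ltn_ord i); have hj := hw j (ltn_ord j).
have ln_le x y : 0 < x -> x <= y -> ln x <= ln y.
  by move=> x0 [xy|->]; [apply/Rlt_le/ln_increasing|lra].
have -> : center w i - center w j = ln (w i) - ln (w j) by rewrite /center; ring.
rewrite /Rdiv ln_mult ?ln_Rinv; try lra; last exact: Rinv_0_lt_compat.
have := ln_le _ _ wm (proj1 hi); have := ln_le _ _ wm (proj1 hj).
have := ln_le (w i) _ ltac:(lra) (proj2 hi); have := ln_le (w j) _ ltac:(lra) (proj2 hj).
by split_Rabs; lra.
Qed.

Section Consequences.
Variables (n : nat) (w : nat -> R) (th : 'I_n -> R) (e : R).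
Hypotheses (n_gt0 : (0 < n)%N) (e_le1 : e <= 1) (w_gt0 : forall i, (i < n)%N -> 0 < w i).
Hypothesis th_close : forall i, Rabs (th i - center w i) <= e.

Lemma supnorm_wnorm_gt0 : 0 < supnorm (wnorm n w).
Proof.
apply: Rlt_le_trans (le_supnorm _ (Ordinal n_gt0)); apply: Rabs_pos_lt.
by rewrite /wnorm; have := exp_pos (ln (w (Ordinal n_gt0)) - mean_log n w); lra.
Qed.

Lemma exp_estimator_close i : Rabs (exp (th i) - wnorm n w i) <= 3 * e * supnorm (wnorm n w).
Proof.
have hi := th_close i; set x := th i - center w i in hi.
have -> : exp (th i) - wnorm n w i = wnorm n w i * (exp x - 1).
  have -> : th i = center w i + x by rewrite /x; ring.
  by rewrite exp_plus /wnorm -/(center w i); ring.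
have h1 := exp_minus_one_le (Rle_trans _ _ _ hi e_le1).
rewrite Rabs_mult Rmult_comm; apply: Rmult_le_compat; try exact: Rabs_pos; first lra.
exact: le_supnorm.
Qed.

Lemma relative_error : supnorm (fun i => exp (th i) - wnorm n w i) / supnorm (wnorm n w) <= 3 * e.
Proof.
have W0 := supnorm_wnorm_gt0; have e0 : 0 <= e.
  by have := th_close (Ordinal n_gt0); have := Rabs_pos (th (Ordinal n_gt0) - center w (Ordinal n_gt0)); lra.
apply: (Rmult_le_reg_r (supnorm (wnorm n w))) => //.
rewrite /Rdiv Rmult_assoc Rinv_l ?Rmult_1_r; last lra.
apply: supnorm_le => [|i]; last exact: exp_estimator_close.
by apply: Rmult_le_pos; lra.
Qed.

(** Each exponentiated entry errs by at most [3 * e * S], and [S <= wmax / m] turns the separation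
    into a gap above [6 * e * S]; [exp] is increasing. *)
Lemma top_K_recovery (K : nat) (wmax : R) : (0 < K)%N -> (K < n)%N -> 0 < wmax ->
  (forall i, (i < n)%N -> w i <= wmax) ->
  (forall i j, (i <= j)%N -> (j < n)%N -> w j <= w i) ->
  6 * e < (w (K - 1)%N - w K) / wmax ->
  forall i j : 'I_n, (i < K)%N -> (K <= j)%N -> th j < th i.
Proof.
move=> K0 Kn wm wle mono sep i j iK Kj.
pose m := exp (mean_log n w); have m0 : 0 < m by exact: exp_pos.
have wn k : wnorm n w k = w k / m.
  by rewrite /wnorm /Rminus exp_plus exp_Ropp exp_ln //; apply: w_gt0.
have W : supnorm (wnorm n w) <= wmax / m.
  have wm0 : 0 <= wmax / m by apply/Rlt_le/Rdiv_lt_0_compat.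
  apply: supnorm_le => // k; rewrite wn Rabs_right.
    by apply: Rmult_le_compat_r; [apply/Rlt_le/Rinv_0_lt_compat|apply: wle].
  by apply/Rle_ge/Rlt_le/Rdiv_lt_0_compat => //; apply: w_gt0.
have W0 := supnorm_wnorm_gt0; set S := supnorm (wnorm n w) in W W0.
have Sm : S * m <= wmax.
  have := Rmult_le_compat_r m _ _ (Rlt_le _ _ m0) W.
  by rewrite /Rdiv Rmult_assoc Rinv_l; lra.
have e0 : 0 <= e by have := th_close i; have := Rabs_pos (th i - center w i); lra.
have gap : 6 * e * S < wnorm n w i - wnorm n w j.
  have h1 : w (K - 1)%N <= w i by apply: mono; [rewrite -ltnS subn1 prednK|rewrite subn1 prednK // ltnW].
  have h2 : w j <= w K by apply: mono.
  rewrite !wn; apply: (Rmult_lt_reg_r m) => //.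
  have -> : (w i / m - w j / m) * m = w i - w j by field; lra.
  have h3 : 6 * e * wmax < w (K - 1)%N - w K.
    have -> : w (K - 1)%N - w K = (w (K - 1)%N - w K) / wmax * wmax by field; lra.
    exact: Rmult_lt_compat_r.
  have : 6 * e * (S * m) <= 6 * e * wmax by apply: Rmult_le_compat_l => //; lra.
  by lra.
apply: exp_lt_inv; have := exp_estimator_close i; have := exp_estimator_close j.
by rewrite -/S; move: gap; split_Rabs; lra.
Qed.

End Consequences.

(** With [c1 = 8 * C ^ 2] the sample size condition is the square of the conclusion. In the
    application [K4] is [kap ^ 2]. *)
Lemma separation_of_sample_size (n N L K4 lnn C e c1 D : R) :
  0 < n -> 0 < N * L -> 0 <= C -> 0 < e -> 0 < D -> 0 < K4 -> c1 = 8 * C ^ 2 ->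
  N * L * e ^ 2 = lnn ->
  n * N * L / 2 >= c1 * K4 ^ 2 * n * lnn / D ^ 2 -> 4 * C * (K4 * e) <= D.
Proof.
move=> n0 NL C0 e0 D0 K0 -> <- /Rge_le hyp; have D2 : 0 < D ^ 2 by nra.
apply: Rsqr_incr_0_var; last lra; rewrite !Rsqr_pow2.
have := Rmult_le_compat_r (D ^ 2) _ _ (Rlt_le _ _ D2) hyp.
rewrite /Rdiv (Rmult_assoc _ (/ D ^ 2)) Rinv_l; last lra.
move=> hyp2; apply: (Rmult_le_reg_l (n * (N * L))); first exact: Rmult_lt_0_compat.
have -> : (4 * C * (K4 * e)) ^ 2 = 16 * C ^ 2 * K4 ^ 2 * e ^ 2 by ring.
by lra.
Qed.

Theorem theorem6 (c2 c3 clam : R) :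
  0 < c2 -> 0 < c3 -> 0 < clam ->
  exists c0 c1 C Cp : R, 0 < c0 /\ 0 < c1 /\ 0 < C /\ 0 < Cp /\
  forall (n L K : nat) (p wmin wmax kappa lam : R) (w : nat -> R),
    (2 <= n)%N -> (0 < L)%N -> (0 < K)%N -> (K < n)%N ->
    0 < wmin ->
    (forall i, (i < n)%N -> wmin <= w i <= wmax) ->
    (forall i j, (i <= j)%N -> (j < n)%N -> w j <= w i) ->
    kappa = wmax / wmin -> 1 < kappa ->
    p <= 1 ->
    c0 * kappa ^ 4 * ln (INR n) / INR n <= p ->
    INR L <= c2 * Rpower (INR n) c3 ->
    lam = clam * (1 / ln kappa) * sqrt (INR n * p * ln (INR n) / INR L) ->
    prob p w
      (fun om : outcome n L =>
         forall th : 'I_n -> R, is_minimizer (reg_loss lam om) th ->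
           (* (1) relative l_inf error bound *)
           supnorm (fun i : 'I_n => exp (th i) - wnorm n w i) / supnorm (wnorm n w)
             <= C * kappa ^ 2 * sqrt (ln (INR n) / (INR n * p * INR L))
           /\
           (* (2) exact top-K recovery, Delta_K = (w_K - w_{K+1})/wmax (1-based) *)
           (0 < (w (K - 1)%N - w K) / wmax ->
            INR n ^ 2 * p * INR L / 2 >=
              c1 * kappa ^ 4 * INR n * ln (INR n) / ((w (K - 1)%N - w K) / wmax) ^ 2 ->
            forall i j : 'I_n, (i < K)%N -> (K <= j)%N -> th j < th i))
    >= 1 - Cp / INR n ^ 5.
Proof.
move=> _ _ clam0; have C0 := err_const_ge clam0; set C2 := err_const clam in C0.
(* [C2 ^ 2] is what [kap_q_small] needs, the factor 3 comes from [exp_minus_one_le], 8 from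
   [separation_of_sample_size], and 10 from the union bound. *)
exists (C2 ^ 2), (8 * (3 * C2) ^ 2), (3 * C2), 10.
do 4?[split; first by nra].
move=> n L K p wmin wmax kap lam w n2 L0 K0 Kn wm wb mono kapE kap1 p1 pge _ lamE.
have n0 : (0 < n)%N by apply: leq_trans n2.
have w0 i : (i < n)%N -> 0 < w i by move=> /wb; lra.
have cdiff := center_diff_le wm wb; rewrite -kapE in cdiff.
apply: (@prob_ge n L p w _ (@chernoff_sum n L p kap lam w)).
- by split => //; apply/Rlt_le; apply: (p_gt0 n2 kap1 clam0 pge).
- exact: w0.
- by move=> om; repeat apply: Rplus_le_le_0_compat; apply: sumR_ge0 => *; apply/Rlt_le/exp_pos.
- move=> [G Y] good th min.
  pose eps := sqrt (ln (INR n) / (INR n * p * INR L)).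
  have close := good_minimizer n2 L0 w0 kap1 clam0 p1 cdiff pge lamE good min.
  have small := err_small n2 L0 kap1 clam0 pge.
  rewrite -/eps -/C2 in close small.
  split.
    apply: Rle_trans (relative_error n0 small close) _; rewrite -/eps; right; ring.
  move=> Dpos hyp; have wM : 0 < wmax by have := wb 0%N n0; lra.
  have epos : 0 < eps := eps_gt0 n2 L0 kap1 clam0 pge.
  have k2 : 0 < kap ^ 2 by apply: pow_lt; lra.
  apply: (top_K_recovery n0 small w0 close K0 Kn wM) => //; first by move=> i /wb; lra.
  have NL : 0 < INR n * p * INR L.
    by apply: Rmult_lt_0_compat; [exact: (N_gt0 n2 kap1 clam0 pge)|have := L_ge1R L0; lra].
  have nR := n_ge2R n2.
  have sep := @separation_of_sample_size (INR n) (INR n * p) (INR L) (kap ^ 2) (ln (INR n))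
    (3 * C2) eps _ _ ltac:(lra) NL ltac:(lra) epos Dpos k2 erefl
    (eps_sq n2 L0 kap1 clam0 pge).
  have kpos : 0 < kap ^ 2 * eps by apply: Rmult_lt_0_compat.
  (* [sep] gives the factor 12 where recovery asks for 6; the slack and [kpos] supply the strict
     inequality. *)
  apply: Rlt_le_trans (sep _); first by nra.
  have -> : INR n * (INR n * p) * INR L / 2 = INR n ^ 2 * p * INR L / 2 by field.
  by have -> : (kap ^ 2) ^ 2 = kap ^ 4 by ring.
- exact: (expect_chernoff_sum lam n2 L0 w0 kap1 clam0 p1 cdiff pge).
Qed.
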